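(* Fix $c>0$. There exists $l^*=l^*(c)>0$ such that for every $l>l^*$ the energy $$F(Q_{11}, Q_{12}, M_1, M_2) = \int_{-1}^{1} \Big\{\tfrac{l}{2}\left[(Q_{11}')^2 + (Q_{12}')^2 + (M_1')^2 + (M_2')^2 \right] + \left( Q_{11}^2 + Q_{12}^2 - 1 \right)^2 + \tfrac{1}{4}\left(M_1^2 + M_2^2 - 1 \right)^2 - cQ_{11}\left(M_1^2 - M_2^2 \right) - 2c Q_{12}M_1 M_2 \Big\}\,\mathrm{d}y$$ has a unique critical point (and hence a unique global minimiser) in the admissible space $\mathcal{A}$.
   Context: Here $'$ denotes $\frac{\mathrm{d}}{\mathrm{d}y}$. The admissible space $\mathcal{A}$ is the set of all $(Q_{11},Q_{12},M_1,M_2)$ with every component in $W^{1,2}([-1,1];\mathbb{R})$ satisfying $Q_{11}(-1)=M_1(-1)=1$, $Q_{11}(1)=M_1(1)=-1$, $Q_{12}(-1)=Q_{12}(1)=M_2(-1)=M_2(1)=0$. A critical point of $F$ in $\mathcal{A}$ is an element of $\mathcal{A}$ at which the first variation of $F$ vanishes for all perturbations with components in $W^{1,2}_0$, i.e. a solution of the Euler--Lagrange equations $$l\, Q_{11}'' = 4 Q_{11}(Q_{11}^2 + Q_{12}^2 - 1) - c\left(M_1^2 - M_2^2 \right),\quad l\, Q_{12}'' = 4 Q_{12}(Q_{11}^2 + Q_{12}^2 - 1) - 2cM_1 M_2,$$ $$l\, M_1'' = M_1 \left(M_1^2 + M_2^2 - 1 \right) - 2c Q_{11}M_1 - 2c Q_{12}M_2,\quad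 l\, M_2'' = M_2 \left(M_1^2 + M_2^2 - 1 \right) + 2c Q_{11} M_2 - 2c Q_{12} M_1.$$ *)

(* Defs.v *)
From HB Require Import structures.
From mathcomp Require Import all_boot all_order all_algebra.
From mathcomp Require Import all_classical all_reals all_analysis.
Set Implicit Arguments.
Unset Strict Implicit.
Unset Printing Implicit Defensive.
Import Order.TTheory GRing.Theory Num.Theory.
Import numFieldNormedType.Exports.
Local Open Scope ring_scope.
Local Open Scope classical_set_scope.

(* Functions on [-1, 1] are represented by total functions on R whose values
   outside [-1, 1] are irrelevant. *)

Section Sobolev.
Variable R : realType.
Implicit Types f g phi : R -> R.
Local Notation mu := (@lebesgue_measure R).

Definition L2 f : Prop := (f \_ `[-1, 1]) \in Lfun mu 2%:E.

(* The C^1_c(]-1, 1[) test functions, as in Brezis' definition of W^{1,p} of an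
   interval; C^oo_c test functions give the same weak derivatives. *)
Definition test_function phi : Prop :=
  let supp := closure [set x | phi x != 0] in
  [/\ forall x, derivable phi x 1, continuous (derive1 phi),
      compact supp & supp `<=` `]-1, 1[].

Definition is_weak_derivative f g : Prop :=
  L2 g /\ forall phi, test_function phi ->
    \int[mu]_(y in `[-1, 1]) (f y * derive1 phi y) =
    - \int[mu]_(y in `[-1, 1]) (g y * phi y).

(* An element of W^{1,2} is given by its continuous representative, so that its
   values at -1 and 1 are its boundary values. *)
Definition W12 f : Prop :=
  [/\ {within `[-1, 1], continuous f}, L2 f & exists g, is_weak_derivative f g].

Definition W12_0 f : Prop := [/\ W12 f, f (-1) = 0 & f 1 = 0].

(* A choice of weak derivative (unique up to a null set when it exists). *)
Definition weak_derive f : R -> R := xget (cst 0) (is_weak_derivative f).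

End Sobolev.

Record config (R : realType) := Config {
  Q11 : R -> R;
  Q12 : R -> R;
  M1 : R -> R;
  M2 : R -> R }.

Section Energy.
Variable R : realType.
Implicit Types (l c t : R) (u v w : config R).
Local Notation mu := (@lebesgue_measure R).

Definition config_eq u v : Prop := forall y, y \in `[-1, 1] ->
  [/\ Q11 u y = Q11 v y, Q12 u y = Q12 v y, M1 u y = M1 v y & M2 u y = M2 v y].

Definition admissible u : Prop :=
  [/\ [/\ W12 (Q11 u), W12 (Q12 u), W12 (M1 u) & W12 (M2 u)],
      [/\ Q11 u (-1) = 1, M1 u (-1) = 1, Q11 u 1 = -1 & M1 u 1 = -1] &
      [/\ Q12 u (-1) = 0, Q12 u 1 = 0, M2 u (-1) = 0 & M2 u 1 = 0]].

Definition perturbation v : Prop :=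
  [/\ W12_0 (Q11 v), W12_0 (Q12 v), W12_0 (M1 v) & W12_0 (M2 v)].

Definition energy_density l c u (y : R) : R :=
  l / 2 * (weak_derive (Q11 u) y ^+ 2 + weak_derive (Q12 u) y ^+ 2
           + weak_derive (M1 u) y ^+ 2 + weak_derive (M2 u) y ^+ 2)
  + (Q11 u y ^+ 2 + Q12 u y ^+ 2 - 1) ^+ 2
  + 1 / 4 * (M1 u y ^+ 2 + M2 u y ^+ 2 - 1) ^+ 2
  - c * Q11 u y * (M1 u y ^+ 2 - M2 u y ^+ 2)
  - 2 * c * Q12 u y * M1 u y * M2 u y.

Definition energy l c u : R :=
  \int[mu]_(y in `[-1, 1]) energy_density l c u y.

Definition perturb u t v : config R :=
  Config (fun y => Q11 u y + t * Q11 v y) (fun y => Q12 u y + t * Q12 v y)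
         (fun y => M1 u y + t * M1 v y) (fun y => M2 u y + t * M2 v y).

Definition critical_point l c u : Prop :=
  admissible u /\ forall v, perturbation v ->
    is_derive (0 : R) (1 : R) (fun t : R => energy l c (perturb u t v)) 0.

Definition global_minimiser l c u : Prop :=
  admissible u /\ forall w, admissible w -> energy l c u <= energy l c w.

End Energy.

(* Main.v *)
Require Import Defs.
From mathcomp Require Import all_boot all_order all_algebra.
From mathcomp Require Import all_classical all_reals all_analysis.
From mathcomp Require Import measurable_realfun lra ring.
Import Order.TTheory GRing.Theory Num.Theory.
Import numFieldNormedType.Exports.
Local Open Scope ring_scope.
Local Open Scope classical_set_scope.
Set Implicit Arguments.
Unset Strict Implicit.
Unset Printing Implicit Defensive.

(* For large [l] the Euler-Lagrange equations with [Q12 = M2 = 0] form a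
   two-point boundary value problem whose Green operator, divided by [l], is a
   contraction; Picard iteration gives a solution [u] with [|Q11|, |M1| <= 2],
   a bound independent of [l].  For [v] in W^{1,2}_0 the energy of [u + t v] is a
   quartic polynomial in [t] without linear term.  As [u] is bounded and the
   quartic coefficient dominates the cubic one, [F (u + v) - F u] and the
   derivative of [F (u + t v)] at [t = 1] are bounded below by
   [(l / 2) |v'|^2 - K |v|^2] and [l |v'|^2 - K |v|^2] (L^2 norms), where [K]
   depends only on [c].  By Poincare's inequality both are positive for [l] large
   unless [v = 0]; the first makes [u] the only minimiser, the second the only
   critical point.  Neither the direct method nor a maximum principle is needed. *)

(** * The potential along a perturbation *)

(** A competitor [w] is only known to lie in W^{1,2}. No Euler-Lagrange equation is derived for it:
    it is tested in the single direction [w - u], and all integrations by parts fall on the C^2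
    solution [u]. The main obstacle is that no a priori bound on [w] is available, while the cubic
    terms in [w - u] have no sign. They are therefore absorbed by completing squares with the
    quartic terms, pointwise in [y], which costs only a multiple of the square of [w - u] and uses a
    bound on [u] alone. That bound is 2 because [u] differs by at most 1 from the affine function
    with the same boundary values. *)

Section PotentialInequalities.
Variable R : realFieldType.

(* [coefk] is the coefficient of [t ^ k] in the potential part of the energy
   density at [(Q + t q1, t q2, M + t m1, t m2)]. *)
Definition coef2 (c Q M q1 q2 m1 m2 : R) :=
  4 * (Q * q1) ^+ 2 + 2 * (Q ^+ 2 - 1) * (q1 ^+ 2 + q2 ^+ 2)
  + (M * m1) ^+ 2 + 1 / 2 * (M ^+ 2 - 1) * (m1 ^+ 2 + m2 ^+ 2)
  - c * (Q * (m1 ^+ 2 - m2 ^+ 2) + 2 * M * (q1 * m1 + q2 * m2)).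

Definition coef3 (c Q M q1 q2 m1 m2 : R) :=
  4 * (Q * q1) * (q1 ^+ 2 + q2 ^+ 2) + (M * m1) * (m1 ^+ 2 + m2 ^+ 2)
  - c * (q1 * (m1 ^+ 2 - m2 ^+ 2) + 2 * q2 * m1 * m2).

Definition coef4 (q1 q2 m1 m2 : R) :=
  (q1 ^+ 2 + q2 ^+ 2) ^+ 2 + 1 / 4 * (m1 ^+ 2 + m2 ^+ 2) ^+ 2.

(** One constant for both inequalities below. The demanding one is [remainder_derivative_ge]: there
    the squares of [m1], [m2] lose [10 + 1] and twice the coupling [4 * c], and the squares of [q1],
    [q2] lose [9 / 2 * c ^+ 2], rounded up to [5 * c ^+ 2]. *)
Definition coercivity (c : R) := 11 + 8 * c + 5 * c ^+ 2.

Lemma sqr_le4 (x : R) : `|x| <= 2 -> x ^+ 2 <= 4.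
Proof. by rewrite ler_norml => /andP[? ?]; nra. Qed.

Lemma coupling_quadratic (c Q M q1 q2 m1 m2 : R) : 0 <= c -> `|Q| <= 2 -> `|M| <= 2 ->
  c * (Q * (m1 ^+ 2 - m2 ^+ 2) + 2 * M * (q1 * m1 + q2 * m2)) <=
  2 * c * (q1 ^+ 2 + q2 ^+ 2) + 4 * c * (m1 ^+ 2 + m2 ^+ 2).
Proof.
move=> c0; rewrite !ler_norml => /andP[Q1 Q2] /andP[M1 M2].
have h1 : Q * (m1 ^+ 2 - m2 ^+ 2) <= 2 * (m1 ^+ 2 + m2 ^+ 2).
  have := sqr_ge0 m1; have := sqr_ge0 m2; nra.
have h2 x y : 2 * M * (x * y) <= 2 * (x ^+ 2 + y ^+ 2).
  (* The bound 2 on [M] makes both weights [(2 + M) / 2] and [(2 - M) / 2] nonnegative. *)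
  rewrite -subr_ge0 (_ : _ - _ = (2 + M) / 2 * (x - y) ^+ 2 + (2 - M) / 2 * (x + y) ^+ 2).
    by rewrite addr_ge0// mulr_ge0 ?sqr_ge0//; lra.
  by field.
have := h2 q1 m1; have := h2 q2 m2 => h3 h4.
rewrite -subr_ge0 (_ : _ - _ = c * (2 * (q1 ^+ 2 + q2 ^+ 2) + 4 * (m1 ^+ 2 + m2 ^+ 2)
  - (Q * (m1 ^+ 2 - m2 ^+ 2) + 2 * M * (q1 * m1 + q2 * m2)))); last by ring.
by apply: mulr_ge0 => //; lra.
Qed.

(* The cubic coupling has norm at most [c |q| |m| ^ 2] and is absorbed by the
   quartic term in [m]. *)
Lemma coupling_cubic (c e q1 q2 m1 m2 : R) : 0 < e ->
  c * (q1 * (m1 ^+ 2 - m2 ^+ 2) + 2 * q2 * m1 * m2) <=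
  c ^+ 2 / (4 * e) * (q1 ^+ 2 + q2 ^+ 2) + e * (m1 ^+ 2 + m2 ^+ 2) ^+ 2.
Proof.
move=> e0; rewrite -subr_ge0.
(* The pair [m1 ^+ 2 - m2 ^+ 2], [2 * m1 * m2] is the complex square of [m1 + i m2], so its squared
   length is [(m1 ^+ 2 + m2 ^+ 2) ^+ 2]; the rest is completing the square. *)
rewrite (_ : _ - _ = e * ((m1 ^+ 2 - m2 ^+ 2 - c / (2 * e) * q1) ^+ 2
   + (2 * m1 * m2 - c / (2 * e) * q2) ^+ 2)); last by field; lra.
by rewrite mulr_ge0 ?addr_ge0 ?sqr_ge0 ?ltW.
Qed.

(** The terms in [Q * q1] and [C] form the exact square [h4]. In [m], the coupling takes [1 / 8] of
    the available [1 / 4] of [C' ^+ 2]; the other eighth completes the square [h5] at the price of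
    one extra [(M * m1) ^+ 2], which is at most [4 * C']. *)
Lemma remainder_ge (c Q M q1 q2 m1 m2 : R) : 0 <= c -> `|Q| <= 2 -> `|M| <= 2 ->
  - coercivity c * (q1 ^+ 2 + q2 ^+ 2 + m1 ^+ 2 + m2 ^+ 2) <=
  coef2 c Q M q1 q2 m1 m2 + coef3 c Q M q1 q2 m1 m2 + coef4 q1 q2 m1 m2.
Proof.
move=> c0 bQ bM.
have h1 := coupling_quadratic q1 q2 m1 m2 c0 bQ bM.
have h2 := @coupling_cubic c (1 / 8) q1 q2 m1 m2 ltac:(lra).
have bM2 := sqr_le4 bM; have M0 := sqr_ge0 M; have Q0 := sqr_ge0 Q.
have m10 := sqr_ge0 m1; have m20 := sqr_ge0 m2.
have q10 := sqr_ge0 q1; have q20 := sqr_ge0 q2.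
rewrite /coef2 /coef3 /coef4 /coercivity.
move: h1 h2; set X := _ * (Q * _ + _); set Y := c * (q1 * _ + _) => h1 h2.
set C := q1 ^+ 2 + q2 ^+ 2 in h1 h2 *; set C' := m1 ^+ 2 + m2 ^+ 2 in h1 h2 *.
have C0 : 0 <= C by rewrite addr_ge0. have C'0 : 0 <= C' by rewrite addr_ge0.
have h3 : (M * m1) ^+ 2 <= 4 * C'.
  by rewrite exprMn ler_pM// /C'; lra.
have h4 : 0 <= (2 * (Q * q1) + C) ^+ 2 by exact: sqr_ge0.
have h5 : 0 <= (2 * (M * m1) + C' / 2) ^+ 2 by exact: sqr_ge0.
have h6 : 0 <= Q ^+ 2 * C by exact: mulr_ge0.
have h7 : 0 <= M ^+ 2 * C' by exact: mulr_ge0.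
have h8 : 0 <= c * C by exact: mulr_ge0.
have h9 : 0 <= c * C' by exact: mulr_ge0.
have h10 : 0 <= c ^+ 2 * C by apply: mulr_ge0 => //; exact: sqr_ge0.
have h11 : 0 <= c ^+ 2 * C' by apply: mulr_ge0 => //; exact: sqr_ge0.
have e2 : c ^+ 2 / (4 * (1 / 8)) = 2 * c ^+ 2 by field.
rewrite e2 in h2; rewrite -[C + _ + _]addrA -/C'; clearbody X Y C C'.
lra.
Qed.

(** The weights 2, 3, 4 come from differentiating in [t] at [t = 1]. With [1 / 6] the tripled
    coupling uses half of [C' ^+ 2]; completing the squares [h4] and [h5] now needs an extra
    [(Q * q1) ^+ 2] as well as [5 / 2] of [(M * m1) ^+ 2]. *)
Lemma remainder_derivative_ge (c Q M q1 q2 m1 m2 : R) : 0 <= c -> `|Q| <= 2 -> `|M| <= 2 ->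
  - coercivity c * (q1 ^+ 2 + q2 ^+ 2 + m1 ^+ 2 + m2 ^+ 2) <=
  2 * coef2 c Q M q1 q2 m1 m2 + 3 * coef3 c Q M q1 q2 m1 m2 + 4 * coef4 q1 q2 m1 m2.
Proof.
move=> c0 bQ bM.
have h1 := coupling_quadratic q1 q2 m1 m2 c0 bQ bM.
have h2 := @coupling_cubic c (1 / 6) q1 q2 m1 m2 ltac:(lra).
have bM2 := sqr_le4 bM; have M0 := sqr_ge0 M; have Q0 := sqr_ge0 Q.
have bQ2 := sqr_le4 bQ.
have m10 := sqr_ge0 m1; have m20 := sqr_ge0 m2.
have q10 := sqr_ge0 q1; have q20 := sqr_ge0 q2.
rewrite /coef2 /coef3 /coef4 /coercivity.
move: h1 h2; set X := _ * (Q * _ + _); set Y := c * (q1 * _ + _) => h1 h2.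
set C := q1 ^+ 2 + q2 ^+ 2 in h1 h2 *; set C' := m1 ^+ 2 + m2 ^+ 2 in h1 h2 *.
have C0 : 0 <= C by rewrite addr_ge0. have C'0 : 0 <= C' by rewrite addr_ge0.
have h3 : (M * m1) ^+ 2 <= 4 * C'.
  by rewrite exprMn ler_pM// /C'; lra.
have h3' : (Q * q1) ^+ 2 <= 4 * C.
  by rewrite exprMn ler_pM// /C; lra.
have h4 : 0 <= (3 * (Q * q1) + 2 * C) ^+ 2 by exact: sqr_ge0.
have h5 : 0 <= (3 * (M * m1) + C') ^+ 2 by exact: sqr_ge0.
have h6 : 0 <= Q ^+ 2 * C by exact: mulr_ge0.
have h7 : 0 <= M ^+ 2 * C' by exact: mulr_ge0.
have h8 : 0 <= c * C by exact: mulr_ge0.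
have h9 : 0 <= c * C' by exact: mulr_ge0.
have h10 : 0 <= c ^+ 2 * C by apply: mulr_ge0 => //; exact: sqr_ge0.
have h11 : 0 <= c ^+ 2 * C' by apply: mulr_ge0 => //; exact: sqr_ge0.
have e2 : c ^+ 2 / (4 * (1 / 6)) = 3 / 2 * c ^+ 2 by field.
rewrite e2 in h2; rewrite -[C + _ + _]addrA -/C'; clearbody X Y C C'.
lra.
Qed.

End PotentialInequalities.
(** * Square integrable and continuous functions on [-1, 1] *)

Section WeakDerivatives.
Variable R : realType.
Implicit Types f g h p : R -> R.
Local Notation mu := (@lebesgue_measure R).
Local Notation I := (`[(-1 : R), 1]%classic : set R).
Local Notation intI f := (mu.-integrable I (EFin \o f)).

(* A constant rather than a notation, so that continuity goals can be decomposed
   by syntactic matching. *)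
Definition contI f := {within I, continuous f}.

Lemma integrableI_restrict h :
  intI h <-> mu.-integrable setT (EFin \o (h \_ I)).
Proof.
by rewrite -restrict_EFin; apply: integrable_mkcond; exact: measurable_itv.
Qed.

Lemma restrict_sqr h : (fun y => (h \_ I) y ^+ 2) = (fun y => h y ^+ 2) \_ I.
Proof.
by apply/funext => y; rewrite !patchE; case: ifP => //= _; rewrite expr0n.
Qed.

Lemma L2P f : L2 f <-> measurable_fun I f /\ intI (fun y => f y ^+ 2).
Proof.
rewrite /L2; split.
- move=> Lf; split.
    have := set_mem (sub_Lfun_mfun Lf) => /=.
    by move/(measurable_restrictT f (measurable_itv _)).
  apply/integrableI_restrict; have := Lfun2_integrable_sqr Lf.
  by rewrite restrict_sqr.
- move=> [mf /integrableI_restrict intf]; rewrite inE; apply/andP; split.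
    by rewrite inE /=; apply/(measurable_restrictT f (measurable_itv _)).
  rewrite inE /= /finite_norm unlock poweR_lty//=.
  move/integrableP : intf => [_].
  apply: le_lt_trans; rewrite le_eqVlt; apply/orP; left; apply/eqP.
  apply: eq_integral => y _ /=.
  by rewrite -restrict_sqr powR_mulrn// -normrX.
Qed.

Lemma L2_measurable f : L2 f -> measurable_fun I f.
Proof. by case/L2P. Qed.

Lemma contI_measurable f : contI f -> measurable_fun I f.
Proof. by move=> cf; apply: subspace_continuous_measurable_fun. Qed.

Lemma contI_integrable f : contI f -> intI f.
Proof.
by move=> cf; apply: continuous_compact_integrable => //; exact: segment_compact.
Qed.

Lemma contI_bounded f : contI f -> [bounded f x | x in I].
Proof.
move=> cf.
have /compact_bounded[M [_ mrt]] := continuous_compact cf (@segment_compact _ _ _).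
by exists M; split; rewrite ?num_real // => ? ? ? ?; exact: mrt.
Qed.

Lemma contID f g : contI f -> contI g -> contI (fun y => f y + g y).
Proof. by move=> cf cg y; apply: cvgD; [exact: cf|exact: cg]. Qed.

Lemma contIM f g : contI f -> contI g -> contI (fun y => f y * g y).
Proof. by move=> cf cg y; apply: cvgM; [exact: cf|exact: cg]. Qed.

Lemma contI_cst (k : R) : contI (fun _ => k).
Proof. by move=> y; exact: cvg_cst. Qed.

Lemma contIN f : contI f -> contI (fun y => - f y).
Proof. by move=> cf y; apply: cvgN; exact: cf. Qed.

Lemma contIX f n : contI f -> contI (fun y => f y ^+ n).
Proof.
move=> cf; elim: n => [|n ih]; first exact: contI_cst.
rewrite (_ : (fun y => _) = fun y => f y * f y ^+ n); first exact: contIM.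
by apply/funext => y; rewrite exprS.
Qed.

Lemma continuous_contI f : continuous f -> contI f.
Proof. by move=> cf; exact: continuous_subspaceT. Qed.

Lemma contI_L2 f : contI f -> L2 f.
Proof.
move=> cf; apply/L2P; split; first exact: contI_measurable.
exact/contI_integrable/contIX.
Qed.

Lemma L2D f g : L2 f -> L2 g -> L2 (fun y => f y + g y).
Proof.
move=> Lf Lg.
rewrite /L2 (_ : _ \_ _ = f \_ I \+ g \_ I); last first.
  apply/funext => y /=; rewrite !patchE.
  by case: ifP => //; rewrite addr0.
have := @Lfun_addr_closed _ _ R mu 2%:E _.
by rewrite lee1n => /(_ erefl)[_]; apply.
Qed.

Lemma L2Z (k : R) f : L2 f -> L2 (fun y => k * f y).
Proof.
move=> Lf.
rewrite /L2 (_ : _ \_ _ = k \o* (f \_ I)); last first.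
  apply/funext => y /=; rewrite !patchE.
  by case: ifP => //; rewrite ?mul0r // mulrC.
by apply: Lfun_scale => //; rewrite ler1n.
Qed.

Lemma L2N f : L2 f -> L2 (fun y => - f y).
Proof.
move/(@L2Z (-1)); congr L2.
by apply/funext => y; rewrite mulN1r.
Qed.

Lemma L2M_integrable f g : L2 f -> L2 g -> intI (fun y => f y * g y).
Proof.
move=> Lf Lg; apply/integrableI_restrict.
have /Lfun1_integrable := Lfun2_mul_Lfun1 Lf Lg.
congr (integrable _ _ (EFin \o _)); apply/funext => y /=.
by rewrite !patchE; case: ifP => //; rewrite mul0r.
Qed.

Lemma L2_integrable f : L2 f -> intI f.
Proof.
move=> Lf; have := L2M_integrable (contI_L2 (@contI_cst 1)) Lf.
by congr (integrable _ _ _); apply/funext => y /=; rewrite mul1r.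
Qed.

Lemma L2_contI f p : L2 f -> contI p -> L2 (fun y => f y * p y).
Proof.
move=> /L2P[mf Lf] cp; apply/L2P; split.
  by apply: measurable_funM => //; exact: contI_measurable.
have cp2 := contIX (n:=2) cp.
have := @integrableMr _ _ R mu I (measurable_itv _) _ _ (contI_measurable cp2) (contI_bounded cp2) Lf.
by congr (integrable _ _ _); apply/funext => y; rewrite /= -EFinM mulrC exprMn.
Qed.

Implicit Types u v w q phi : R -> R.
Lemma intID f g : intI f -> intI g -> intI (fun y => f y + g y).
Proof.
move=> intf intg.
exact: (@integrableD _ _ R mu I (measurable_itv _) (EFin \o f) (EFin \o g)).
Qed.

Lemma intIZ (k : R) f : intI f -> intI (fun y => k * f y).
Proof.
by move=> intf; exact: (@integrableZl _ _ R mu I (measurable_itv _) k (EFin \o f)).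
Qed.

Lemma intIN f : intI f -> intI (fun y => - f y).
Proof.
by move=> intf; exact: (@integrableN _ _ R mu I (EFin \o f)).
Qed.

Lemma RintID f g : intI f -> intI g ->
  \int[mu]_(y in I) (f y + g y) = \int[mu]_(y in I) f y + \int[mu]_(y in I) g y.
Proof. by move=> intf intg; apply: RintegralD => //; exact: measurable_itv. Qed.

Lemma RintIZ (k : R) f : intI f ->
  \int[mu]_(y in I) (k * f y) = k * \int[mu]_(y in I) f y.
Proof. by move=> intf; apply: RintegralZl => //; exact: measurable_itv. Qed.

Lemma RintIN f : intI f ->
  \int[mu]_(y in I) (- f y) = - \int[mu]_(y in I) f y.
Proof.
move=> intf; rewrite -[RHS]mulN1r -RintIZ//.
by apply: eq_Rintegral => y _; rewrite mulN1r.
Qed.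

Lemma le_RintI f g : intI f -> intI g -> (forall y, I y -> f y <= g y) ->
  \int[mu]_(y in I) f y <= \int[mu]_(y in I) g y.
Proof. by move=> intf intg fg; apply: le_Rintegral => //; exact: measurable_itv. Qed.

Lemma le_normr_RintI f : intI f ->
  `|\int[mu]_(y in I) f y| <= \int[mu]_(y in I) `|f y|.
Proof. by move=> intf; apply: le_normr_Rintegral => //; exact: measurable_itv. Qed.

(** * Weak derivatives *)

(** Derivatives are taken on the whole line, so that -1 and 1 require no one-sided derivatives. *)
Definition C1 (u u' : R -> R) :=
  (forall x : R, is_derive x (1 : R) u (u' x)) /\ continuous u'.

Lemma derivable_continuous u : (forall x, derivable u x (1 : R)) -> continuous u.
Proof.
by move=> du x; apply: differentiable_continuous; apply/derivable1_diffP; exact: du.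
Qed.

Lemma C1_continuous u u' : C1 u u' -> continuous u.
Proof. by move=> [du _]; apply: derivable_continuous => x; have [] := du x. Qed.

Lemma C1_cst (k : R) : C1 (fun _ => k) (fun _ => 0).
Proof. by split=> x; [exact: is_derive_cst|exact: cvg_cst]. Qed.

Lemma derivable_LR u (a b : R) : (forall x, derivable u x (1 : R)) ->
  derivable_oo_LRcontinuous u a b.
Proof.
move=> du; have cu := derivable_continuous du.
by split => [x _||]; [exact: du|apply: cvg_at_right_filter; exact: cu|
  apply: cvg_at_left_filter; exact: cu].
Qed.

Lemma C1_derive1 u u' : C1 u u' -> derive1 u = u'.
Proof.
by move=> [du _]; apply/funext => x; rewrite derive1E; have [_] := du x.
Qed.

Lemma test_functionP phi : test_function phi ->
  exists2 phi', C1 phi phi' & derive1 phi = phi'.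
Proof.
move=> [d1 c1 _ _]; exists (derive1 phi); last by [].
split; last exact: c1.
move=> x.
by apply: DeriveDef; [exact: d1|rewrite derive1E].
Qed.

Lemma test_function_out phi x : test_function phi -> ~ (`]-1, 1[ x) -> phi x = 0.
Proof.
move=> [_ _ _ sub] nx; apply: contrapT => /eqP px; apply: nx.
by apply: sub; exact: subset_closure.
Qed.

Lemma C1_ibp u u' v v' : C1 u u' -> C1 v v' ->
  \int[mu]_(y in I) (u y * v' y) =
  (u 1 * v 1 - u (-1) * v (-1)) - \int[mu]_(y in I) (u' y * v y).
Proof.
move=> cu cv; have [du cu'] := cu; have [dv cv'] := cv.
apply: Rintegration_by_parts.
- by rewrite (lt_trans (ltrN10 _)).
- exact: continuous_subspaceT.
- by apply: derivable_LR => x; have [] := du x.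
- by move=> x _; rewrite (C1_derive1 cu).
- exact: continuous_subspaceT.
- by apply: derivable_LR => x; have [] := dv x.
- by move=> x _; rewrite (C1_derive1 cv).
Qed.

Lemma C1_weak_derivative u u' : C1 u u' -> is_weak_derivative u u'.
Proof.
move=> cu; split; first by apply/contI_L2/continuous_contI; case: cu.
move=> phi tphi; have [phi' cphi ->] := test_functionP tphi.
rewrite (C1_ibp cu cphi) !(test_function_out tphi) ?mulr0 ?subr0 ?sub0r//=;
  by rewrite in_itv/= ltxx ?andbF.
Qed.

Lemma C1M u u' v v' : C1 u u' -> C1 v v' ->
  C1 (fun y => u y * v y) (fun y => u y * v' y + v y * u' y).
Proof.
move=> cu cv; have [du cu'] := cu; have [dv cv'] := cv; split.
  by move=> x; have ? := du x; have ? := dv x; apply: is_derive_eq.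
have cu0 := C1_continuous cu; have cv0 := C1_continuous cv.
by move=> x; apply: cvgD; apply: cvgM; [exact: cu0|exact: cv'|exact: cv0|exact: cu'].
Qed.

Lemma test_functionM q q' phi : C1 q q' -> test_function phi ->
  test_function (fun y => q y * phi y).
Proof.
move=> cq tphi; have [phi' cphi ephi] := test_functionP tphi.
have cqphi := C1M cq cphi; case: (tphi) => _ _ cpt sub.
have sub2 : closure [set x | q x * phi x != 0] `<=` closure [set x | phi x != 0].
  by apply: closure_subset => x /=; apply: contra_neq => ->; rewrite mulr0.
split.
- by move=> x; have [] := cqphi.1 x.
- by rewrite (C1_derive1 cqphi); case: cqphi.
- by apply: subclosed_compact cpt sub2; exact: closed_closure.
- exact: subset_trans sub2 sub.
Qed.

Lemma test_function_contI phi : test_function phi -> contI phi /\ contI (derive1 phi).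
Proof.
move=> [d c _ _]; split; apply: continuous_contI; last exact: c.
exact: (derivable_continuous d).
Qed.

(** The weak derivative of [v] is tested with [q * phi], which is a test function because test
    functions are only required to be C^1. *)
Lemma weak_derivativeM v g q q' : contI v -> is_weak_derivative v g -> C1 q q' ->
  is_weak_derivative (fun y => v y * q y) (fun y => g y * q y + v y * q' y).
Proof.
move=> cv [Lg wg] cq.
have cIq : contI q by apply/continuous_contI/C1_continuous/cq.
have cIq' : contI q' by apply/continuous_contI; case: cq.
split; first by apply: L2D; [exact: L2_contI|exact/contI_L2/contIM].
move=> phi tphi; have tq := test_functionM cq tphi.
have [cphi cphi'] := test_function_contI tphi.
have [phi' Cphi ephi] := test_functionP tphi; rewrite ephi in cphi' *.
have := wg _ tq; rewrite (C1_derive1 (C1M cq Cphi)) => e.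
have -> : \int[mu]_(y in I) ((g y * q y + v y * q' y) * phi y) =
  \int[mu]_(y in I) (g y * (q y * phi y)) + \int[mu]_(y in I) (v y * (phi y * q' y)).
  rewrite -RintID.
  - by apply: eq_Rintegral => y _; ring.
  - by apply: L2M_integrable => //; exact/contI_L2/contIM.
  - by apply/contI_integrable/contIM/contIM.
rewrite opprD -e -RintIN; last by apply/contI_integrable/contIM/contIM.
rewrite -RintID.
- by apply: eq_Rintegral => y _; ring.
- by apply/contI_integrable/contIM => //; apply: contID; exact: contIM.
- by apply/contI_integrable/contIN/contIM/contIM.
Qed.

Lemma weak_derivative_lin v g w h (k : R) : contI v -> contI w ->
  is_weak_derivative v g -> is_weak_derivative w h ->
  is_weak_derivative (fun y => v y + k * w y) (fun y => g y + k * h y).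
Proof.
move=> cv cw [Lg wg] [Lh wh]; split; first by apply: L2D => //; exact: L2Z.
move=> phi tphi.
have [cphi cphi'] := test_function_contI tphi.
transitivity (\int[mu]_(y in I) (v y * derive1 phi y) +
    k * \int[mu]_(y in I) (w y * derive1 phi y)).
  rewrite -RintIZ; last exact/contI_integrable/contIM.
  rewrite -RintID; first by apply: eq_Rintegral => y _; ring.
  - exact/contI_integrable/contIM.
  - exact/intIZ/contI_integrable/contIM.
rewrite wg// wh// mulrN -RintIZ; last by apply: L2M_integrable => //; exact: contI_L2.
rewrite -opprD -RintID; first by congr (- _); apply: eq_Rintegral => y _; ring.
- by apply: L2M_integrable => //; exact: contI_L2.
- by apply/intIZ/L2M_integrable => //; exact: contI_L2.
Qed.

(** * A smoothed indicator as test function *)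

Definition sgsq (x : R) := x * `|x|.

Lemma is_derive_sgsq (x : R) : is_derive x (1 : R) sgsq (2 * `|x|).
Proof.
have sqD (e : R) : is_derive x (1 : R) (fun y : R => e * (y * y)) (2 * (e * x)).
  by apply: is_derive_eq; rewrite !scaler1 /GRing.scale /=; ring.
have [x0|x0|->] := ltgtP x 0.
- apply: (@near_eq_is_derive _ _ _ (fun y : R => -1 * (y * y))) => //.
  + near=> y; rewrite /sgsq ler0_norm; first ring.
    by apply/ltW; near: y; exact: lt_nbhsl.
  + by have := sqD (-1); rewrite ltr0_norm// [-1 * x]mulN1r.
- apply: (@near_eq_is_derive _ _ _ (fun y : R => 1 * (y * y))) => //.
  + near=> y; rewrite /sgsq ger0_norm; first ring.
    by apply/ltW; near: y; exact: lt_nbhsr.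
  + by have := sqD 1; rewrite gtr0_norm// [1 * x]mul1r.
- rewrite normr0 mulr0.
  have h : (fun h : R => h^-1 *: (sgsq (h *: (1 : R) + 0) - sgsq 0)) @ 0^' --> (0 : R).
    rewrite /sgsq mul0r.
    have nc : (fun h : R => `|h|) @ 0^' --> (0 : R).
      rewrite -[X in _ --> X](normr0 R); apply: cvg_within_filter.
      exact: norm_continuous.
    apply: cvg_trans nc; apply: near_eq_cvg; near=> h.
    have h0 : h != 0 by near: h; exact: nbhs_dnbhs_neq.
    by rewrite /GRing.scale /= mulr1 addr0 subr0 mulrA mulVf// mul1r.
  by apply: DeriveDef; [apply/cvg_ex; exists 0|apply: cvg_lim].
Unshelve. all: by end_near. Qed.

(* Second differences of the C^1 function [x |x|] are constant outside a compact
   set; the derivative [step'] is a hat function on [[0, 1]]. *)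
Definition step (x : R) :=
  sgsq x - 2 * sgsq (x - 1/2) + sgsq (x - 1) + 1/2.
Definition step' (x : R) := 2 * `|x| - 4 * `|x - 1/2| + 2 * `|x - 1|.

Lemma step_lt0 x : x <= 0 -> step x = 0.
Proof.
by move=> x0; rewrite /step /sgsq !ler0_norm; [lra|lra|lra|lra]. Qed.

Lemma step_gt1 x : 1 <= x -> step x = 1.
Proof. by move=> x1; rewrite /step /sgsq !ger0_norm; [lra|lra|lra|lra]. Qed.

Lemma step_bound x : `|step x| <= 1.
Proof.
have [x0|x0] := leP x 0; first by rewrite step_lt0// normr0 ler01.
have [x1|x1] := leP 1 x; first by rewrite step_gt1// normr1.
rewrite /step /sgsq (gtr0_norm x0) (@ltr0_norm _ (x - 1)); last by lra.
have [xh|xh] := leP x (1/2).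
- rewrite (@ler0_norm _ (x - 1/2)); last by lra.
  by rewrite ler_norml; apply/andP; split; nra.
- rewrite (@gtr0_norm _ (x - 1/2)); last by lra.
  by rewrite ler_norml; apply/andP; split; nra.
Qed.

Lemma step'_ge0 x : 0 <= step' x.
Proof.
(* Convexity of the absolute value at [x - 1/2], the midpoint of [x] and [x - 1]. *)
rewrite /step'; have := ler_normD x (x - 1).
have -> : x + (x - 1) = 2 * (x - 1/2) by lra.
rewrite normrM gtr0_norm//; lra.
Qed.

Lemma step'_out x : x <= 0 \/ 1 <= x -> step' x = 0.
Proof.
rewrite /step'; case=> x0.
- by rewrite !ler0_norm; [lra|lra|lra|lra].
- by rewrite !ger0_norm; [lra|lra|lra|lra].
Qed.

Lemma is_derive_affine_comp (k b x df : R) (f : R -> R) :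
  is_derive (k * (x - b)) (1 : R) f df ->
  is_derive x (1 : R) (fun y => f (k * (y - b))) (k * df).
Proof.
move=> fdf.
have daff : is_derive x (1 : R) (fun y : R => k * (y - b)) k.
  by apply: is_derive_eq; rewrite subr0 /GRing.scale /= mulr1.
by have := @is_derive1_comp _ f (fun y : R => k * (y - b)) x df k fdf daff; rewrite mulrC.
Qed.

Lemma is_derive_step x : is_derive x (1 : R) step (step' x).
Proof.
have d0 := is_derive_sgsq x.
have d (b : R) : is_derive x (1 : R) (fun y => sgsq (y - b)) (2 * `|x - b|).
  have := @is_derive_affine_comp 1 b x _ sgsq (is_derive_sgsq _).
  by rewrite !mul1r; under eq_fun do rewrite mul1r.
have d1 := d (1/2); have d2 := d 1.
apply: is_derive_eq; rewrite /step' /GRing.scale /=; ring.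
Qed.

Lemma continuous_norm_shift (b : R) : continuous (fun x : R => `|x - b|).
Proof.
move=> x; apply: (@continuous_comp _ _ _ (fun x => x - b) (fun x => `|x|)).
  by apply: cvgB; [exact: cvg_id|exact: cvg_cst].
exact: norm_continuous.
Qed.

Lemma continuous_step' : continuous step'.
Proof.
have c := continuous_norm_shift.
move=> x; apply: cvgD; first apply: cvgB.
- by apply: cvgMr; exact: norm_continuous.
- by apply: cvgMr; exact: c.
- by apply: cvgMr; exact: c.
Qed.

Section Shift.
Variables (a h : R).
Hypothesis h0 : 0 < h.

Definition shift_step y := step (h^-1 * (y - a)).
Definition shift_step' y := h^-1 * step' (h^-1 * (y - a)).

Lemma C1_shift_step : C1 shift_step shift_step'.
Proof.
split=> x; first exact/is_derive_affine_comp/is_derive_step.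
apply: cvgMr; apply: (@continuous_comp _ _ _ (fun y => h^-1 * (y - a)) step').
  by apply: cvgMr; apply: cvgB; [exact: cvg_id|exact: cvg_cst].
exact: continuous_step'.
Qed.

Lemma shift_step_left y : y <= a -> shift_step y = 0.
Proof.
by move=> ya; rewrite /shift_step step_lt0// pmulr_rle0 ?invr_gt0// subr_le0.
Qed.

Lemma shift_step_right y : a + h <= y -> shift_step y = 1.
Proof.
move=> ya; rewrite /shift_step step_gt1// -ler_pdivrMl ?invr_gt0//.
by rewrite invrK mulr1; lra.
Qed.

Lemma shift_step'_ge0 y : 0 <= shift_step' y.
Proof. by rewrite mulr_ge0 ?invr_ge0 ?(ltW h0) ?step'_ge0. Qed.

Lemma shift_step'_out y : ~~ (a < y < a + h) -> shift_step' y = 0.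
Proof.
rewrite negb_and -!leNgt => /orP[ya|ya]; rewrite /shift_step' step'_out ?mulr0//.
- by left; rewrite pmulr_rle0 ?invr_gt0// subr_le0.
- by right; rewrite -ler_pdivrMl ?invr_gt0// invrK mulr1; lra.
Qed.

Lemma int_shift_step' : -1 <= a -> a + h <= 1 ->
  \int[mu]_(y in I) shift_step' y = 1.
Proof.
move=> a1 ah.
(* Integration by parts against the constant 1 is the fundamental theorem of calculus. *)
have := C1_ibp (C1_cst 1) C1_shift_step.
under eq_Rintegral do rewrite mul1r.
move=> ->; rewrite !mul1r (shift_step_left a1) (shift_step_right ah).
under eq_Rintegral do rewrite mul0r.
by rewrite /Rintegral integral0/= !subr0.
Qed.

(** [shift_step'] is a probability density concentrated on the interval from [a] to [a + h], so the
    integral is an average of [v] there. The point [x0] will be an endpoint, -1 or [b], lying close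
    to that interval but outside it. *)
Lemma mollify v (x0 e : R) : contI v -> -1 <= a -> a + h <= 1 ->
  (forall y, I y -> a < y < a + h -> `|v y - v x0| <= e) ->
  `|\int[mu]_(y in I) (v y * shift_step' y) - v x0| <= e.
Proof.
move=> cv a1 ah ve.
have cs : contI shift_step' by apply/continuous_contI; case: C1_shift_step.
have -> : \int[mu]_(y in I) (v y * shift_step' y) - v x0 =
    \int[mu]_(y in I) ((v y - v x0) * shift_step' y).
  have e1 : v x0 = \int[mu]_(y in I) (v x0 * shift_step' y).
    by rewrite RintIZ ?int_shift_step' ?mulr1//; exact: contI_integrable.
  rewrite [X in _ - X = _]e1 -RintIN; last exact/contI_integrable/contIM/cs/contI_cst.
  rewrite -RintID; first by apply: eq_Rintegral => y _; ring.
  - exact/contI_integrable/contIM.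
  - exact/contI_integrable/contIN/contIM/cs/contI_cst.
have cd : contI (fun y => (v y - v x0) * shift_step' y).
  by apply: contIM => //; apply: contID => //; exact: contI_cst.
apply: le_trans (le_normr_RintI (contI_integrable cd)) _.
have e1 : e = \int[mu]_(y in I) (e * shift_step' y).
  by rewrite RintIZ ?int_shift_step' ?mulr1//; exact: contI_integrable.
rewrite [leRHS]e1; apply: le_RintI.
- by apply: integrable_norm; exact: contI_integrable.
- exact/intIZ/contI_integrable.
- move=> y Iy; have [ya|ya] := boolP (a < y < a + h).
    by rewrite normrM (ger0_norm (shift_step'_ge0 y)) ler_wpM2r ?shift_step'_ge0// ve.
  by rewrite shift_step'_out// !mulr0 normr0.
Qed.

End Shift.

Lemma contI_near v (x e : R) : contI v -> I x -> 0 < e ->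
  exists2 d : R, 0 < d & forall y, I y -> `|y - x| < d -> `|v y - v x| <= e.
Proof.
move=> /subspace_continuousP cv Ix e0.
have /cvgrPdist_le /(_ _ e0) := cv _ Ix.
move=> /nbhs_ballP [d /= d0 dv]; exists d => // y Iy yx.
by rewrite distrC; apply: dv => //; rewrite /ball /= distrC.
Qed.

Lemma test_function_steps (a b h : R) : 0 < h -> -1 < a -> a + h <= b -> b + h < 1 ->
  test_function (fun y => shift_step a h y - shift_step b h y) /\
  derive1 (fun y => shift_step a h y - shift_step b h y) =
    (fun y => shift_step' a h y - shift_step' b h y).
Proof.
move=> h0 a1 ab b1.
have Ca := C1_shift_step a h; have Cb := C1_shift_step b h.
have C : C1 (fun y => shift_step a h y - shift_step b h y)
    (fun y => shift_step' a h y - shift_step' b h y).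
  split=> x; last by apply: cvgB; [exact: Ca.2|exact: Cb.2].
  by have ? := Ca.1 x; have ? := Cb.1 x; apply: is_derive_eq.
have sub : closure [set y | shift_step a h y - shift_step b h y != 0] `<=`
    `[a, b + h].
  rewrite [X in _ `<=` X](closure_id _).1; last exact: itv_closed.
  apply: closure_subset => y /=; apply: contra_neqT => ny.
  have [ya|ya] := leP y a.
    rewrite !shift_step_left ?subrr//; lra.
  have [yb|yb] := leP (b + h) y; first by rewrite !shift_step_right ?subrr//; lra.
  by move: ny; rewrite in_itv /= (ltW ya) (ltW yb).
split; last exact: (C1_derive1 C).
split.
- by move=> x; have [] := C.1 x.
- by rewrite (C1_derive1 C); exact: C.2.
- apply: subclosed_compact sub; [exact: closed_closure|exact: segment_compact].
- move=> y /sub /=; rewrite !in_itv /= => /andP[ya yb]; apply/andP; split; lra.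
Qed.

(* The test functions increase from 0 to 1 just to the right of -1 and decrease
   back to 0 just to the left of [b]. *)
Lemma weak_derivative_steps v g (b : R) (h : R^nat) : contI v -> is_weak_derivative v g ->
  -1 < b <= 1 -> (forall n, 0 < h n) -> (forall n, 4 * h n <= b + 1) ->
  h n @[n --> \oo] --> (0 : R) ->
  \int[mu]_(y in I) (g y * (shift_step (-1 + h n) (h n) y
                            - shift_step (b - 2 * h n) (h n) y)) @[n --> \oo]
    --> v b - v (-1).
Proof.
move=> cv [Lg wg] /andP[b1 b2] h0 h1 hc.
apply/cvgrPdist_le => e e0; have e20 : 0 < e / 2 by rewrite divr_gt0.
have I1 : I (-1) by rewrite /= in_itv /= lexx /=; lra.
have Ib : I b by rewrite /= in_itv /= b2 (ltW b1).
have [d1 d10 dv1] := contI_near cv I1 e20.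
have [d2 d20 dv2] := contI_near cv Ib e20.
near=> n.
have hn0 := h0 n; have hn1 := h1 n.
have hd1 : 2 * h n < d1.
  rewrite -ltr_pdivlMl//; near: n.
  by apply: (cvgr_lt _ hc); rewrite mulr_gt0 ?invr_gt0.
have hd2 : 2 * h n < d2.
  rewrite -ltr_pdivlMl//; near: n.
  by apply: (cvgr_lt _ hc); rewrite mulr_gt0 ?invr_gt0.
have [t dt] : test_function (fun y => shift_step (-1 + h n) (h n) y
      - shift_step (b - 2 * h n) (h n) y) /\
    derive1 (fun y => shift_step (-1 + h n) (h n) y
      - shift_step (b - 2 * h n) (h n) y) =
    (fun y => shift_step' (-1 + h n) (h n) y
      - shift_step' (b - 2 * h n) (h n) y).
  (* The condition [4 * h n <= b + 1] says exactly that the rise ends at [-1 + 2 * h n] before the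
     fall starts at [b - 2 * h n]. *)
  by apply: test_function_steps => //; lra.
have cs a : contI (shift_step' a (h n)) by apply/continuous_contI; case: (C1_shift_step a (h n)).
have m1 : `|\int[mu]_(y in I) (v y * shift_step' (-1 + h n) (h n) y) - v (-1)| <= e / 2.
  apply: mollify => //; [lra|lra|move=> y Iy /andP[ya yb]].
  by apply: dv1 => //; rewrite ltr_norml; apply/andP; split; lra.
have m2 : `|\int[mu]_(y in I) (v y * shift_step' (b - 2 * h n) (h n) y) - v b| <= e / 2.
  apply: mollify => //; [lra|lra|move=> y Iy /andP[ya yb]].
  by apply: dv2 => //; rewrite ltr_norml; apply/andP; split; lra.
have := wg _ t; rewrite dt => /esym/eqP; rewrite eqr_oppLR => /eqP ->.
have -> : \int[mu]_(y in I) (v y * (shift_step' (-1 + h n) (h n) y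
      - shift_step' (b - 2 * h n) (h n) y)) =
  \int[mu]_(y in I) (v y * shift_step' (-1 + h n) (h n) y) -
  \int[mu]_(y in I) (v y * shift_step' (b - 2 * h n) (h n) y).
  rewrite -RintIN; last exact/contI_integrable/contIM.
  rewrite -RintID; first by apply: eq_Rintegral => y _; ring.
  - exact/contI_integrable/contIM.
  - exact/contI_integrable/contIN/contIM.
move: m1 m2; rewrite !ler_norml => /andP[? ?] /andP[? ?]; apply/andP; split; lra.
Unshelve. all: by end_near. Qed.

Lemma steps_cvg (b y : R) (h : R^nat) : -1 < b -> -1 <= y ->
  (forall n, 0 < h n) -> (forall n, 4 * h n <= b + 1) ->
  h n @[n --> \oo] --> (0 : R) ->
  shift_step (-1 + h n) (h n) y - shift_step (b - 2 * h n) (h n) y @[n --> \oo]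
    --> (if (-1 < y < b) then 1 else 0 : R).
Proof.
move=> b1 y1 h0 h1 hc.
have [/andP[ya yb]|] := boolP (-1 < y < b).
- have cst1 : (fun _ : nat => (1 : R)) @ \oo --> (1 : R) by exact: cvg_cst.
  apply: cvg_trans cst1;  apply: near_eq_cvg; near=> n.
  have hn0 := h0 n.
  rewrite shift_step_right//; last first.
    have : h n <= (y + 1) / 2; last by lra.
    by near: n; apply: (cvgr_le _ hc); lra.
  rewrite shift_step_left ?subr0//.
  have : h n <= (b - y) / 2; last by lra.
  by near: n; apply: (cvgr_le _ hc); lra.
- rewrite negb_and -!leNgt => yab.
  have cst0 : (fun _ : nat => (0 : R)) @ \oo --> (0 : R) by exact: cvg_cst.
  apply: cvg_trans cst0;  apply: near_eq_cvg; near=> n.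
  have hn0 := h0 n; have hn1 := h1 n.
  case/orP: yab => yab; first by rewrite !shift_step_left ?subrr//; lra.
  by rewrite !shift_step_right ?subrr//; lra.
Unshelve. all: by end_near. Qed.

(** The fundamental theorem of calculus for weak derivatives. The integrals of [g * phi n] have two
    limits: the boundary values of [v], through the definition of a weak derivative, and the
    integral of [g], by dominated convergence. *)
Lemma weak_derivative_integral v g (b : R) : contI v -> is_weak_derivative v g ->
  -1 < b <= 1 -> \int[mu]_(y in `]-1, b[) g y = v b - v (-1).
Proof.
move=> cv wvg b1; have [Lg wg] := wvg.
pose h n : R := (b + 1) / 4 * harmonic n.
have b0 : 0 < (b + 1) / 4 by case/andP: b1 => ? _; lra.
have h0 n : 0 < h n by rewrite /h mulr_gt0 ?harmonic_gt0.
have h1 n : 4 * h n <= b + 1.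
  have : h n <= (b + 1) / 4; last by lra.
  by rewrite /h ger_pMr// /harmonic invf_le1// ler1n.
have hc : h n @[n --> \oo] --> (0 : R).
  rewrite -(mulr0 ((b + 1) / 4)); apply: cvgMr; exact: cvg_harmonic.
pose phi n y := shift_step (-1 + h n) (h n) y - shift_step (b - 2 * h n) (h n) y.
have lim1 := weak_derivative_steps cv wvg b1 h0 h1 hc.
have cphi n : contI (phi n).
  apply: contID; last apply: contIN.
  - exact/continuous_contI/C1_continuous/C1_shift_step.
  - exact/continuous_contI/C1_continuous/C1_shift_step.
have igphi n : intI (fun y => g y * phi n y) by apply: L2M_integrable => //; exact: contI_L2.
have ig := L2_integrable Lg.
have Pb : `]-1, b[ = I `&` `]-1, b[ :> set R.
  apply/seteqP; split=> y /=; rewrite !in_itv /=; last by case.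
  move=> /andP[ya yb]; split; last by rewrite ya yb.
  by case/andP: b1 => _ b2; rewrite (ltW ya) (le_trans (ltW yb)).
have mf : measurable_fun I (EFin \o (g \_ `]-1, b[)).
  apply/measurable_EFinP/measurable_restrict; [exact: measurable_itv..|].
  by rewrite -Pb; apply: measurable_funS (L2_measurable Lg);
    [exact: measurable_itv|rewrite Pb; exact: subIsetl].
have pw : {ae mu, forall y, I y -> (EFin \o (fun y => g y * phi n y)) y @[n --> \oo]
    --> (EFin \o (g \_ `]-1, b[)) y}.
  apply: aeW => y; rewrite /= in_itv /= => /andP[y1 _].
  apply: cvg_EFin; first exact: nearW.
  rewrite patchE mem_setE in_itv /=.
  have : g y * phi n y @[n --> \oo] --> g y * (if -1 < y < b then 1 else 0).
    by apply: cvgMr; apply: steps_cvg => //; case/andP: b1.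
  by case: ifP => _; rewrite ?mulr1 ?mulr0.
have ig2 : intI (fun y => 2 * `|g y|) by apply/intIZ/integrable_norm.
have dom : {ae mu, forall y n, I y ->
    (`|(g y * phi n y)%R%:E| <= (2 * `|g y|)%R%:E)%E}.
  apply: aeW => y n Iy /=; rewrite lee_fin normrM mulrC ler_wpM2r//.
  rewrite (le_trans (ler_normB _ _))//.
  by have := step_bound ((h n)^-1 * (y - (-1 + h n)));
     have := step_bound ((h n)^-1 * (y - (b - 2 * h n)));
     rewrite /shift_step; lra.
have [iP _ lim2] := @dominated_convergence _ _ R mu I (measurable_itv _)
  _ _ _ (fun n => measurable_int mu (igphi n)) mf pw ig2 dom.
suff lim3 : \int[mu]_(y in I) (g y * phi n y) @[n --> \oo] --> \int[mu]_(y in `]-1, b[) g y.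
  by apply/esym; exact: (@cvg_unique R (@Rhausdorff R) _ _ _ _ lim1 lim3).
rewrite [in X in _ --> X]Pb Rintegral_mkcondr.
apply: fine_cvg; rewrite fineK; first exact: lim2.
exact: (@integrable_fin_num _ _ R mu I (measurable_itv _) _ iP).
Qed.

(** * Sobolev and Poincaré inequalities, integration by parts, uniqueness of weak derivatives *)

Lemma RintI_cst (k : R) : \int[mu]_(y in I) k = 2 * k.
Proof.
rewrite Rintegral_cst; last exact: measurable_itv.
have mI : mu I = EFin 2.
  rewrite (lebesgue_measure_itv `[(-1 : R), 1]%R) /= lte_fin ifT; last by lra.
  by rewrite -EFinB opprK.
by rewrite mulrC; congr (_ * _); rewrite [LHS](congr1 fine mI).
Qed.

Lemma RintI_oo f : intI f -> \int[mu]_(y in `]-1, 1[) f y = \int[mu]_(y in I) f y.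
Proof.
move=> intf; rewrite Rintegral_itv_bndo_bndc; last first.
  apply: integrableS intf; [exact: measurable_itv|exact: measurable_itv|].
  by move=> y /=; rewrite !in_itv /= => /andP[/ltW -> /ltW ->].
rewrite Rintegral_itv_obnd_cbnd//.
apply: integrableS intf; [exact: measurable_itv|exact: measurable_itv|].
by move=> y /=; rewrite !in_itv /= => /andP[/ltW -> ->].
Qed.

(** Cauchy-Schwarz in linearised form: the square of [g] dominates [2 * t * g - t ^+ 2] before [y]
    and [- t ^+ 2] after it. Integrating gives [2 * t * v y - 2 * t ^+ 2], which is largest at
    [t = v y / 2]. *)
Lemma sobolev_bound v g y : contI v -> is_weak_derivative v g -> v (-1) = 0 -> I y ->
  v y ^+ 2 <= 2 * \int[mu]_(x in I) (g x ^+ 2).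
Proof.
move=> cv wvg v0 Iy; have [Lg _] := wvg.
have [y1 y2] : -1 <= y /\ y <= 1 by move: Iy; rewrite /= in_itv /= => /andP[].
have ig2 : intI (fun x => g x ^+ 2) by case/L2P: Lg.
have [ym|ym] := eqVneq y (-1).
  rewrite ym v0 expr0n /= mulr_ge0//.
  by apply: Rintegral_ge0 => x _; exact: sqr_ge0.
have y3 : -1 < y by rewrite lt_neqAle eq_sym ym.
have := @weak_derivative_integral v g y cv wvg; rewrite y3 y2 v0 subr0 => /(_ isT).
have Pb : `]-1, y[ = I `&` `]-1, y[ :> set R.
  apply/seteqP; split=> z /=; rewrite !in_itv /=; last by case.
  move=> /andP[ya yb]; split; last by rewrite ya yb.
  by rewrite (ltW ya) (le_trans (ltW yb)).
rewrite Pb Rintegral_mkcondr => iv.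
have iP : intI (g \_ `]-1, y[).
  rewrite -restrict_EFin; apply/integrable_restrict; [exact: measurable_itv..|].
  apply: integrableS (L2_integrable Lg); [exact: measurable_itv| |exact: subIsetl].
  by apply: measurableI; exact: measurable_itv.
set t := v y / 2.
have : \int[mu]_(x in I) (2 * t * (g \_ `]-1, y[) x - t ^+ 2) <= \int[mu]_(x in I) (g x ^+ 2).
  apply: le_RintI => //.
    by apply: intID; [exact: intIZ|exact/contI_integrable/contI_cst].
  move=> x _; rewrite patchE; case: ifP => _.
    by rewrite -subr_ge0 (_ : _ - _ = (g x - t) ^+ 2) ?sqr_ge0//; ring.
  by rewrite mulr0 sub0r (le_trans _ (sqr_ge0 _))// oppr_le0 sqr_ge0.
rewrite RintID; [|exact: intIZ|exact/contI_integrable/contI_cst].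
rewrite RintIZ// iv RintI_cst /t; lra.
Qed.

Lemma poincare v g : contI v -> is_weak_derivative v g -> v (-1) = 0 ->
  \int[mu]_(x in I) (v x ^+ 2) <= 4 * \int[mu]_(x in I) (g x ^+ 2).
Proof.
move=> cv wvg v0.
have -> : 4 * \int[mu]_(x in I) (g x ^+ 2) =
    \int[mu]_(x in I) (2 * \int[mu]_(x in I) (g x ^+ 2)).
  by rewrite RintI_cst; ring.
apply: le_RintI; [exact/contI_integrable/contIX|exact/contI_integrable/contI_cst|].
by move=> y Iy; exact: (sobolev_bound cv).
Qed.

(** Here [v] is not a test function, so the definition of a weak derivative does not apply directly;
    instead the fundamental theorem is applied to [v * q], which vanishes at both endpoints. With
    [q] the derivative of a component of the solution, this removes the linear term of the
    energy. *)
Lemma weak_derivative_ibp v g q q' : contI v -> is_weak_derivative v g ->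
  v (-1) = 0 -> v 1 = 0 -> C1 q q' ->
  \int[mu]_(y in I) (q y * g y) = - \int[mu]_(y in I) (q' y * v y).
Proof.
move=> cv wvg v0 v1 cq; have [Lg _] := wvg.
have cIq : contI q by apply/continuous_contI/C1_continuous/cq.
have cIq' : contI q' by apply/continuous_contI; case: cq.
have := weak_derivative_integral (contIM cv cIq) (weak_derivativeM cv wvg cq).
move=> /(_ 1); rewrite v0 v1 !mul0r subrr lexx andbT => h.
have {h} := h (lt_trans (ltrN10 _) ltr01).
have i1 : intI (fun y => q y * g y) by apply: L2M_integrable => //; exact: contI_L2.
have i2 : intI (fun y => q' y * v y) by apply/contI_integrable/contIM.
rewrite RintI_oo; last first.
  have := intID i1 i2; congr (integrable _ _ (EFin \o _)); apply/funext => y; ring.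
move=> e; apply/eqP; rewrite -addr_eq0 -RintID//; apply/eqP.
by rewrite -[RHS]e; apply: eq_Rintegral => y _; ring.
Qed.

(** The difference [h] is a weak derivative of 0, so its integral from -1 to any [y] vanishes, and
    Lebesgue differentiation gives [h = 0] almost everywhere. This makes the energy independent of
    the choice made in [weak_derive]. *)
Lemma weak_derivative_unique f g1 g2 : is_weak_derivative f g1 ->
  is_weak_derivative f g2 -> {ae mu, forall y, I y -> g1 y = g2 y}.
Proof.
move=> [Lg1 w1] [Lg2 w2]; pose h y := g1 y + - g2 y.
have Lh : L2 h by apply: L2D => //; exact: L2N.
have wh : is_weak_derivative (fun _ => 0) h.
  split=> // phi tphi; have [cphi _] := test_function_contI tphi.
  under eq_Rintegral do rewrite mul0r.
  have i1 : intI (fun y => g1 y * phi y) by apply: L2M_integrable => //; exact: contI_L2.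
  have i2 : intI (fun y => g2 y * phi y) by apply: L2M_integrable => //; exact: contI_L2.
  have -> : \int[mu]_(y in I) (h y * phi y) =
      \int[mu]_(y in I) (g1 y * phi y) - \int[mu]_(y in I) (g2 y * phi y).
    rewrite -RintIN// -RintID//; last exact: intIN.
    by apply: eq_Rintegral => y _; rewrite /h; ring.
  have := w1 _ tphi; rewrite w2// => /oppr_inj ->.
  by rewrite subrr oppr0 /Rintegral integral0.
have ih := L2_integrable Lh.
have ihR : mu.-integrable setT (EFin \o (h \_ I)) by apply/integrableI_restrict.
have ihy y : mu.-integrable `]-1, y] (EFin \o (h \_ I)).
  by apply: integrableS ihR; [exact: measurableT|exact: measurable_itv|].
have loc : locally_integrable [set: R] (h \_ I).
  by apply: integrable_locally => //.
have F0 y : -1 < y < 1 -> \int[mu]_(t in `]-1, y]) (h \_ I) t = 0.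
  move=> /andP[y1 y2].
  transitivity (\int[mu]_(t in `]-1, y[) h t); last first.
    rewrite (@weak_derivative_integral _ _ y (@contI_cst 0) wh) ?subrr//.
    by rewrite y1 ltW.
  rewrite -Rintegral_itv_bndo_bndc; last first.
    by apply: integrableS ihR; [exact: measurableT|exact: measurable_itv|].
  apply: eq_Rintegral => t; rewrite inE /= in_itv /= => /andP[t1 t2].
  by rewrite patchE mem_set//= in_itv /= (ltW t1) (ltW (lt_trans t2 y2)).
have := FTC1 ihy loc.
have n1 (x : R) : {ae mu, forall y, y <> x}.
  exists [set x]; split; [exact: measurable_set1|exact: lebesgue_measure_set1|].
  by move=> y /= /contrapT.
have aeF := ae_filter_ringOfSetsType mu.
(* The endpoints are discarded because the primitive is known to vanish only on the open
   interval. *)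
apply: filterS3 (n1 1) (n1 (-1)) => y ny1 ny2 ftc Iy.
have [y1 y2] : -1 < y /\ y < 1.
  move: Iy; rewrite /= in_itv /= => /andP[a b].
  by rewrite !lt_neqAle a b !andbT; split; apply/eqP => // /esym.
have [_] := ftc y1.
rewrite patchE mem_set// derive1E => e.
apply/eqP; rewrite -subr_eq0 -[_ - _]e; apply/eqP.
have : is_derive y (1 : R) (fun x => \int[mu]_(t in `]-1, x]) (h \_ I) t) 0.
  apply: (@near_eq_is_derive _ _ _ (fun _ : R => 0)).
    near=> z; rewrite F0//; apply/andP; split.
      by near: z; exact: lt_nbhsr.
    by near: z; exact: lt_nbhsl.
by case.
Unshelve. all: by end_near. Qed.

(** * The two-point boundary value problem *)

Lemma antiderivative_left0 f (a : R) : continuous f ->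
  (forall y, y <= a -> f y = 0) -> exists F, C1 F f.
Proof.
move=> cf f0.
have fi (u : R) : mu.-integrable `]-oo, u] (EFin \o f).
  have ic : mu.-integrable `[a, u] (EFin \o f).
    apply: continuous_compact_integrable; first exact: segment_compact.
    exact: continuous_subspaceT.
  have i1 : mu.-integrable setT (EFin \o (f \_ `[a, u])).
    by rewrite -restrict_EFin; apply/integrable_restrict;
      [exact: measurable_itv|exact: measurableT|rewrite setTI].
  have : mu.-integrable `]-oo, u] (EFin \o (f \_ `[a, u])).
    by apply: integrableS i1; [exact: measurableT|exact: measurable_itv|].
  apply: eq_integrable; first exact: measurable_itv.
  move=> y; rewrite inE /= in_itv /= => yu; rewrite patchE; case: ifPn => //.
  rewrite mem_setE in_itv /= yu andbT -ltNge => /ltW ya.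
  by rewrite f0.
exists (fun x => \int[mu]_(t in `]-oo, x]) f t); split=> // x.
have xx : x < x + 1 by rewrite ltrDl.
have [||d e] := @continuous_FTC1 R f (BInfty R true) x _ xx (fi (x + 1)).
- by rewrite ltNyr.
- exact: cf.
- by apply: DeriveDef; [exact: d|rewrite -derive1E].
Qed.

Lemma C1_reflect u u' : C1 u u' -> C1 (fun y => - u (- y)) (fun y => u' (- y)).
Proof.
move=> [du cu]; split=> x.
  have dN : is_derive x (1 : R) (fun y : R => - y) (- 1) by apply: is_derive_eq.
  have duN := @is_derive1_comp _ u (fun y : R => - y) x _ _ (du _) dN.
  have d : is_derive x (1 : R) (fun y => - u (- y)) (- (u' (- x) * - 1)).
    exact: is_deriveN.
  by apply: is_derive_eq; rewrite mulrN1 opprK.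
by apply: (@continuous_comp _ _ _ (fun y => - y) u'); [exact: oppr_continuous|exact: cu].
Qed.

Lemma C1D u u' v v' : C1 u u' -> C1 v v' ->
  C1 (fun y => u y + v y) (fun y => u' y + v' y).
Proof.
move=> [du cu] [dv cv]; split=> x; last by apply: cvgD; [exact: cu|exact: cv].
by have ? := du x; have ? := dv x; apply: is_derive_eq.
Qed.

Lemma C1_affine (k m : R) : C1 (fun y => k * y + m) (fun _ => k).
Proof.
split=> x; last exact: cvg_cst.
by apply: is_derive_eq; rewrite addr0 /GRing.scale /= mulr1.
Qed.

(* A partition of unity reduces to functions vanishing near one infinity, whose
   primitives are integrals over a half-line. *)
Lemma antiderivative f : continuous f -> exists F, C1 F f.
Proof.
move=> cf; pose rho (y : R) := (`|y - 0| - `|y - 1| + 1) / 2.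
have crho : continuous rho.
  move=> y; apply: cvgMl; apply: cvgD; last exact: cvg_cst.
  by apply: cvgB; exact: continuous_norm_shift.
have rho0 y : y <= 0 -> rho y = 0.
  by move=> y0; rewrite /rho !ler0_norm; lra.
have rho1 y : 1 <= y -> rho y = 1.
  by move=> y0; rewrite /rho !ger0_norm; lra.
have [|y y0|F1 C1F1] := @antiderivative_left0 (fun y => f y * rho y) 0.
- by move=> y; apply: cvgM; [exact: cf|exact: crho].
- by rewrite rho0// mulr0.
have [|y y0|F2 C1F2] := @antiderivative_left0 (fun y => f (- y) * (1 - rho (- y))) (- 1).
- move=> y; apply: cvgM.
    by apply: (@continuous_comp _ _ _ (fun y => - y) f); [exact: oppr_continuous|exact: cf].
  apply: cvgB; first exact: cvg_cst.
  by apply: (@continuous_comp _ _ _ (fun y => - y) rho); [exact: oppr_continuous|exact: crho].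
- by rewrite rho1 ?subrr ?mulr0//; lra.
have := C1D C1F1 (C1_reflect C1F2).
rewrite (_ : (fun y => _ + f (- - y) * _) = f); first by move=> ?; eexists; eauto.
by apply/funext => y; rewrite opprK; ring.
Qed.

(** The problem [u'' = f] in first-order form; the explicit [p] is what enters the energy and its
    integration by parts. *)
Definition solves_bvp (u p f : R -> R) (al be : R) :=
  [/\ C1 u p, C1 p f, u (-1) = al & u 1 = be].

Lemma bvp_exists f (al be : R) : continuous f -> exists u p, solves_bvp u p f al be.
Proof.
move=> cf; have [P CP] := antiderivative cf.
have [S CS] := antiderivative (C1_continuous CP).
pose k := (be - al - (S 1 - S (-1))) / 2.
pose m := al - S (-1) + k.
exists (fun y => S y + (k * y + m)), (fun y => P y + k); split.
- exact: C1D CS (C1_affine k m).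
- have := C1D CP (C1_affine 0 k).
  by congr C1; apply/funext => y; rewrite ?mul0r ?add0r ?addr0.
- by rewrite /m; ring.
- by rewrite /m /k; field.
Qed.

Lemma C1_lipschitz u u' (k x y : R) : C1 u u' -> I x -> I y ->
  (forall z, I z -> `|u' z| <= k) -> `|u x - u y| <= 2 * k.
Proof.
move=> Cu; wlog xy : x y / y <= x => [hw Ix Iy uk|].
  have [xy|/ltW yx] := leP y x; first exact: hw.
  by rewrite distrC; exact: hw.
rewrite /= !in_itv /= => /andP[x1 x2] /andP[y1 y2] uk.
have [||z + ->] := @MVT_segment _ u u' y x xy.
- by move=> z _; exact: Cu.1.
- exact/continuous_subspaceT/C1_continuous/Cu.
rewrite in_itv /= => /andP[z1 z2].
have uz : `|u' z| <= k.
  by apply: uk; rewrite /= in_itv /= (le_trans y1)// (le_trans z2).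
rewrite normrM mulrC ger0_norm ?subr_ge0// ler_pM// ?subr_ge0//; lra.
Qed.

(** The bound 4 on the Green operator: [p] vanishes somewhere by Rolle's theorem, and passing from
    [f] to [p] and from [p] to [u] each costs a factor 2, the length of the interval. *)
Lemma bvp_bound u p f (k : R) : solves_bvp u p f 0 0 ->
  (forall y, I y -> `|f y| <= k) -> forall y, I y -> `|u y| <= 4 * k.
Proof.
move=> [Cu Cp u0 u1] fk.
have I1 : I (-1) by rewrite /= in_itv /= lexx /=; lra.
have [|||z] := @MVT _ u p (-1) 1.
- by rewrite (lt_trans (ltrN10 _)).
- by move=> z _; exact: Cu.1.
- exact/continuous_subspaceT/C1_continuous/Cu.
rewrite in_itv /= u0 u1 subrr => /andP[z1 z2] pz.
have p0 : p z = 0 by lra.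
have Iz : I z by rewrite /= in_itv /= !ltW.
have pk y : I y -> `|p y| <= 2 * k.
  by move=> Iy; rewrite -[p y]subr0 -p0; exact: C1_lipschitz fk.
move=> y Iy; rewrite -[u y]subr0 -u0.
have -> : 4 * k = 2 * (2 * k) by ring.
exact: C1_lipschitz pk.
Qed.

Lemma geometric_lt (K e : R) : 0 < e -> exists n : nat, K * (1 / 2) ^+ n < e.
Proof.
move=> e0; have c : K * (1 / 2) ^+ n @[n --> \oo] --> (0 : R).
  rewrite -(mulr0 K); apply: cvgMr; apply: cvg_expr.
  by rewrite ger0_norm; lra.
have [n _ /(_ n (leqnn n)) h] := cvgr_lt _ c _ e0.
by exists n.
Qed.

(* The limit is the supremum of the nondecreasing sequence
   [x n - 2 * K * (1 / 2) ^+ n], precomposed with the projection [kap] onto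
   [-1, 1] in order to be continuous on the whole line. *)
Lemma geometric_limit (x : nat -> R -> R) (K : R) :
  (forall n, continuous (x n)) ->
  (forall n y, I y -> `|x n.+1 y - x n y| <= K * (1 / 2) ^+ n) ->
  exists2 X, continuous X & forall n y, I y -> `|X y - x n y| <= 2 * K * (1 / 2) ^+ n.
Proof.
move=> cx dx.
pose kap (y : R) := (`|y - (- 1)| - `|y - 1|) / 2.
have ckap : continuous kap.
  by move=> y; apply: cvgMl; apply: cvgB; exact: continuous_norm_shift.
have Ikap y : I (kap y).
  rewrite /= in_itv /= /kap; apply/andP.
  have [ym|ym] := leP y (-1); first by rewrite !ler0_norm; [split; lra|lra|lra].
  have [y1|y1] := leP y 1; last by rewrite !ger0_norm; [split; lra|lra|lra].
  by rewrite (@ger0_norm _ (y - (-1))) ?(@ler0_norm _ (y - 1)); [split; lra|lra|lra].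
have kapI y : I y -> kap y = y.
  rewrite /= in_itv /= => /andP[y1 y2].
  by rewrite /kap (@ger0_norm _ (y - (-1))) ?(@ler0_norm _ (y - 1)); lra.
have K0 : 0 <= K.
  have := dx 0%N 1 _; rewrite expr0 mulr1 => h.
  by apply: le_trans (h _); rewrite ?normr_ge0//= in_itv /= lexx andbT; lra.
have g0 n : 0 <= K * (1 / 2) ^+ n by rewrite mulr_ge0 ?exprn_ge0//; lra.
(* [2 * K * (1 / 2) ^+ n] is the sum of all increments from [n] on, so [lo] increases, [hi]
   decreases, and the limit lies between them. *)
pose lo n y := x n y - 2 * K * (1 / 2) ^+ n.
pose hi n y := x n y + 2 * K * (1 / 2) ^+ n.
have lohi m n y : I y -> lo m y <= hi n y.
  move=> Iy.
  have lo_nd : {homo lo^~ y : m n / (m <= n)%N >-> m <= n}.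
    apply/nondecreasing_seqP => k.
    have := dx k y Iy; rewrite /lo exprS ler_norml => /andP[? ?]; lra.
  have hi_ni : {homo hi^~ y : m n / (m <= n)%N >-> n <= m}.
    apply/nonincreasing_seqP => k.
    have := dx k y Iy; rewrite /hi exprS ler_norml => /andP[? ?]; lra.
  apply: le_trans (lo_nd _ _ (leq_maxl m n)) _.
  apply: le_trans (hi_ni _ _ (leq_maxr m n)).
  by rewrite /lo /hi; have := g0 (maxn m n); lra.
pose X y := sup (range (lo^~ (kap y))).
have XB n y : `|X y - x n (kap y)| <= 2 * K * (1 / 2) ^+ n.
  have h1 : lo n (kap y) <= X y.
    apply: sup_upper_bound; last by exists n.
    split; first by exists (lo 0%N (kap y)), 0%N.
    by exists (hi 0%N (kap y)) => _ [m _ <-]; exact: lohi.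
  have h2 : X y <= hi n (kap y).
    apply: sup_le_ub; first by exists (lo 0%N (kap y)), 0%N.
    by move=> _ [m _ <-]; exact: lohi.
  by move: h1 h2; rewrite /lo /hi ler_norml => ? ?; apply/andP; split; lra.
exists X; last by move=> n y Iy; have := XB n y; rewrite kapI.
move=> y; apply/cvgrPdist_lt => e e0.
have e3 : 0 < e / 3 by rewrite divr_gt0.
have [n nK] := geometric_lt (2 * K) e3.
have cxk : continuous (x n \o kap) by move=> z; apply: continuous_comp; [exact: ckap|exact: cx].
have /cvgrPdist_lt /(_ _ e3) := cxk y.
apply: filterS => z /= zy.
have := XB n y; have := XB n z.
move: zy; rewrite !ltr_norml !ler_norml => /andP[? ?] /andP[? ?] /andP[? ?].
apply/andP; split; lra.
Qed.

Lemma solves_bvpB u p f v q g (al be : R) :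
  solves_bvp u p f al be -> solves_bvp v q g al be ->
  solves_bvp (fun y => u y - v y) (fun y => p y - q y) (fun y => f y - g y) 0 0.
Proof.
have C1B u1 u1' v1 v1' : C1 u1 u1' -> C1 v1 v1' ->
    C1 (fun y => u1 y - v1 y) (fun y => u1' y - v1' y).
  move=> [du cu] [dv cv]; split=> x; last by apply: cvgB; [exact: cu|exact: cv].
  by have ? := du x; have ? := dv x; apply: is_derive_eq.
by move=> [Cu Cp ul ur] [Cv Cq vl vr]; split;
  [exact: C1B|exact: C1B|rewrite ul vl subrr|rewrite ur vr subrr].
Qed.

Lemma solves_bvp_affine :
  solves_bvp (fun y => - 1 * y + 0) (fun _ => - 1) (fun _ => 0) 1 (-1).
Proof.
split; [exact: C1_affine| |by ring|by ring].
have := C1_affine 0 (- 1); congr C1; apply/funext => y; ring.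
Qed.

(** * Picard iteration for a coupled pair of boundary value problems *)

Section Picard.
Variable N : bool -> R -> R -> R.
Hypothesis N_continuous : forall i f g,
  continuous f -> continuous g -> continuous (fun y => N i (f y) (g y)).
(** Both constants are matched to the factor 4 of [bvp_bound]: [1 / 4] keeps a solution within 1 of
    the affine one, hence bounded by 2, and [1 / 8] makes the iteration contract by [1 / 2]. *)
Hypothesis N_bound : forall i a b, `|a| <= 2 -> `|b| <= 2 -> `|N i a b| <= 1 / 4.
Hypothesis N_lipschitz : forall i a b a' b' d,
  `|a| <= 2 -> `|b| <= 2 -> `|a'| <= 2 -> `|b'| <= 2 ->
  `|a - a'| <= d -> `|b - b'| <= d -> `|N i a b - N i a' b'| <= d / 8.

Let bvp_sol : exists G : (R -> R) -> R -> R,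
  forall f, continuous f -> exists p, solves_bvp (G f) p f 1 (-1).
Proof.
have h f : exists u, continuous f -> exists p, solves_bvp u p f 1 (-1).
  have [cf|ncf] := pselect (continuous f); last by exists f.
  by have [u [p h]] := bvp_exists 1 (-1) cf; exists u => _; exists p.
by have [G hG] := choice h; exists G.
Qed.

Let sol_bound u p f : solves_bvp u p f 1 (-1) ->
  (forall y, I y -> `|f y| <= 1 / 4) -> forall y, I y -> `|u y| <= 2.
Proof.
move=> hu fb y Iy.
have := bvp_bound (solves_bvpB hu solves_bvp_affine) (k := 1/4) _ Iy.
have Iy' := Iy; move: Iy'; rewrite /= in_itv /= => /andP[y1 y2].
have h1 z : I z -> `|f z - 0| <= 1 / 4 by move=> Iz; rewrite subr0 fb.
move=> /(_ h1); rewrite !ler_norml => /andP[? ?]; apply/andP; split; lra.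
Qed.

(** The limit [X] of the iterates is only known to be continuous, so the solution returned is [T X].
    It is C^2 on the whole line and agrees with [X] on [-1, 1], which is why the equation is
    asserted only there. *)
Lemma picard_bvp : exists u p f : bool -> R -> R, forall i,
  [/\ solves_bvp (u i) (p i) (f i) 1 (-1),
      forall y, I y -> f i y = N i (u true y) (u false y) &
      forall y, I y -> `|u i y| <= 2].
Proof.
have [G hG] := bvp_sol.
pose T (x : bool -> R -> R) i := G (fun y => N i (x true y) (x false y)).
pose x n := iter n T (fun _ y => - 1 * y + 0).
have cont_sol u p f al be : solves_bvp u p f al be -> continuous u.
  by move=> [Cu _ _ _]; exact: C1_continuous Cu.
have cN (z : bool -> R -> R) i : (forall j, continuous (z j)) ->
    continuous (fun y => N i (z true y) (z false y)).
  by move=> cz; apply: N_continuous; exact: cz.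
have cx n i : continuous (x n i).
  elim: n i => [|n ih] i /=; first by exact: cont_sol solves_bvp_affine.
  by have [p hp] := hG _ (cN (x n) i ih); exact: cont_sol hp.
have bx n i y : I y -> `|x n i y| <= 2.
  elim: n i y => [|n ih] i y Iy.
    apply: (sol_bound solves_bvp_affine) Iy => z _; rewrite normr0; lra.
  have [p hp] := hG _ (cN (x n) i (cx n)).
  by apply: (sol_bound hp) Iy => z Iz; apply: N_bound; exact: ih.
have contr (z w : bool -> R -> R) (d : R) i :
    (forall j, continuous (z j)) -> (forall j, continuous (w j)) ->
    (forall j y, I y -> `|z j y| <= 2) -> (forall j y, I y -> `|w j y| <= 2) ->
    (forall j y, I y -> `|z j y - w j y| <= d) ->
    forall y, I y -> `|T z i y - T w i y| <= d / 2.
  move=> cz cw bz bw zw y Iy.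
  have [p hp] := hG _ (cN z i cz); have [q hq] := hG _ (cN w i cw).
  have -> : d / 2 = 4 * (d / 8) by field.
  apply: (bvp_bound (solves_bvpB hp hq)) Iy => t It.
  by apply: N_lipschitz; [exact: bz|exact: bz|exact: bw|exact: bw|exact: zw|exact: zw].
have dx n i y : I y -> `|x n.+1 i y - x n i y| <= 4 * (1 / 2) ^+ n.
  elim: n i y => [|n ih] i y Iy.
    rewrite expr0 mulr1 (le_trans (ler_normB _ _))//.
    by have := bx 1%N i y Iy; have := bx 0%N i y Iy; lra.
  have -> : 4 * (1 / 2) ^+ n.+1 = (4 * (1 / 2) ^+ n) / 2 :> R by rewrite exprS; field.
  exact: (contr (x n.+1) (x n) _ i (cx n.+1) (cx n) (bx n.+1) (bx n) ih).
have lim i : exists X, continuous X /\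
    forall n y, I y -> `|X y - x n i y| <= 2 * 4 * (1 / 2) ^+ n.
  have [X cX hX] := geometric_limit (fun n => cx n i) (fun n y => @dx n i y).
  by exists X.
have [X hX] := choice lim.
have cX i : continuous (X i) by case: (hX i).
have bX i y : I y -> `|X i y| <= 2.
  move=> Iy; apply/ler_addgt0Pr => e e0.
  have [n ne] := geometric_lt (2 * 4) e0.
  have := (hX i).2 n y Iy; have := bx n i y Iy.
  rewrite !ler_norml => /andP[? ?] /andP[? ?]; apply/andP; split; lra.
have TX i y : I y -> T X i y = X i y.
  move=> Iy; apply/eqP; rewrite -subr_eq0 -normr_le0; apply/ler_addgt0Pr => e e0.
  rewrite add0r; have [n ne] := geometric_lt (2 * 4) e0.
  have h1 := contr X (x n) _ i cX (cx n) bX (bx n) (fun j z Iz => (hX j).2 n z Iz) y Iy.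
  have h2 := (hX i).2 n.+1 y Iy.
  have h3 : T (x n) i y = x n.+1 i y by [].
  move: h1 h2; rewrite h3 exprS !ler_norml => /andP[? ?] /andP[? ?].
  by apply/andP; split; lra.
have sol i : exists p, solves_bvp (T X i) p (fun y => N i (X true y) (X false y)) 1 (-1).
  exact: hG (cN X i cX).
have [p hp] := choice sol.
exists (T X), p, (fun i y => N i (X true y) (X false y)) => i; split=> // y Iy.
- by rewrite !TX.
- by rewrite TX// bX.
Qed.

End Picard.

(** * The energy around a solution of the equations *)

Lemma ae_eq_RintI f g : measurable_fun I f -> measurable_fun I g ->
  {ae mu, forall y, I y -> f y = g y} ->
  \int[mu]_(y in I) f y = \int[mu]_(y in I) g y.
Proof.
move=> mf mg fg; rewrite /Rintegral; congr fine.
apply: (@ae_eq_integral _ _ R mu I); first exact: measurable_itv.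
- exact/measurable_EFinP.
- exact/measurable_EFinP.
- have aeF := ae_filter_ringOfSetsType mu.
  by apply: filterS fg => y h Iy; rewrite /= h.
Qed.

Lemma RintI_sqr_ge0 f : 0 <= \int[mu]_(y in I) (f y ^+ 2).
Proof. by apply: Rintegral_ge0 => y _; exact: sqr_ge0. Qed.

Lemma weak_deriveP f g : is_weak_derivative f g ->
  is_weak_derivative f (weak_derive f).
Proof. exact: xgetI. Qed.

Lemma C1_W12 u u' : C1 u u' -> W12 u.
Proof.
move=> Cu; have cu := continuous_contI (C1_continuous Cu).
by split; [exact: cu|exact: contI_L2|exists u'; exact: C1_weak_derivative].
Qed.

Lemma W12B u v : W12 u -> W12 v -> W12 (fun y => u y - v y).
Proof.
move=> [cu Lu [g wg]] [cv Lv [h wh]]; split.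
- by apply: contID => //; exact: contIN.
- by apply: L2D => //; exact: L2N.
- exists (fun y => g y + -1 * h y).
  rewrite (_ : (fun y => u y - v y) = fun y => u y + -1 * v y).
    exact: weak_derivative_lin.
  by apply/funext => y; rewrite mulN1r.
Qed.

Ltac continuity := lazymatch goal with
  | |- contI (fun _ => ?k) => refine (@contI_cst k)
  | |- contI (fun y => @?A y + @?B y) =>
    refine (@contID A B _ _); [cbv beta; continuity|cbv beta; continuity]
  | |- contI (fun y => - @?A y) => refine (@contIN A _); cbv beta; continuity
  | |- contI (fun y => @?A y * @?B y) =>
    refine (@contIM A B _ _); [cbv beta; continuity|cbv beta; continuity]
  | |- contI (fun y => @?A y ^+ ?n) => refine (@contIX A n _); cbv beta; continuity
  | |- contI (fun y => ?f y) => change (contI f); continuity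
  | H : contI ?f |- contI ?f => exact H
  end.

Section EnergyExpansion.
Variables (l c : R) (Q M pQ pM fQ fM : R -> R).
Hypothesis c0 : 0 < c.
Hypotheses (solQ : solves_bvp Q pQ fQ 1 (-1)) (solM : solves_bvp M pM fM 1 (-1)).
Hypotheses (bQ : forall y, I y -> `|Q y| <= 2) (bM : forall y, I y -> `|M y| <= 2).
Hypothesis eqQ : forall y, I y ->
  l * fQ y = 4 * Q y * (Q y ^+ 2 - 1) - c * M y ^+ 2.
Hypothesis eqM : forall y, I y ->
  l * fM y = M y * (M y ^+ 2 - 1) - 2 * c * Q y * M y.

Definition base := Config Q (fun _ => 0) M (fun _ => 0).

Lemma admissible_base : admissible base.
Proof.
have [CQ _ Ql Qr] := solQ; have [CM _ Ml Mr] := solM.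
have W0 : W12 (fun _ : R => 0 : R) := C1_W12 (C1_cst 0).
by split; [split; [exact: C1_W12 CQ|exact: W0|exact: C1_W12 CM|exact: W0]|split|split].
Qed.

(** [D] is the integral of the squared derivatives of [v], and [E2] contains [l / 2 * D]. The two
    lower bounds concern the energy at [t = 1] minus that at [t = 0], and its derivative at [t = 1];
    the 4 in front of [coercivity c] is the Poincaré constant. *)
Lemma energy_expansion (v : config R) : perturbation v ->
  exists E0 E2 E3 E4 D : R,
  [/\ forall t, energy l c (perturb base t v) =
        E0 + t ^+ 2 * E2 + t ^+ 3 * E3 + t ^+ 4 * E4,
      (l / 2 - 4 * coercivity c) * D <= E2 + E3 + E4,
      (l - 4 * coercivity c) * D <= 2 * E2 + 3 * E3 + 4 * E4, 0 <= D &
      D <= 0 -> forall y, I y -> [/\ Q11 v y = 0, Q12 v y = 0, M1 v y = 0 & M2 v y = 0]].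
Proof.
case: v => q1 q2 m1 m2 [/= [[cq1 _ [d1 w1]] q1l q1r] [[cq2 _ [d2 w2]] q2l q2r]
  [[cm1 _ [d3 w3]] m1l m1r] [[cm2 _ [d4 w4]] m2l m2r]].
have [CQ CpQ _ _] := solQ; have [CM CpM _ _] := solM.
have cQ : contI Q by apply/continuous_contI/C1_continuous/CQ.
have cM : contI M by apply/continuous_contI/C1_continuous/CM.
have cpQ : contI pQ by apply/continuous_contI; case: CQ.
have cpM : contI pM by apply/continuous_contI; case: CM.
have cfQ : contI fQ by apply/continuous_contI; case: CpQ.
have cfM : contI fM by apply/continuous_contI; case: CpM.
have [Cq1 Cq2 Cm1 Cm2] : [/\ contI q1, contI q2, contI m1 & contI m2] by split.
have wQ := C1_weak_derivative CQ; have wM := C1_weak_derivative CM.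
have w0 := C1_weak_derivative (C1_cst 0).
have [[L1 _] [L2' _] [L3 _] [L4 _]] := And4 w1 w2 w3 w4.
pose e0 y := l / 2 * (pQ y ^+ 2 + pM y ^+ 2) + (Q y ^+ 2 - 1) ^+ 2
  + 1 / 4 * (M y ^+ 2 - 1) ^+ 2 - c * Q y * M y ^+ 2.
(* [q2] and [m2] are absent: the density is unchanged when [Q12] and [M2] both change sign, and both
   vanish at [base]. *)
pose e1 y := l * (pQ y * d1 y + pM y * d3 y)
  + ((4 * Q y * (Q y ^+ 2 - 1) - c * M y ^+ 2) * q1 y
  + (M y * (M y ^+ 2 - 1) - 2 * c * Q y * M y) * m1 y).
pose r2 y := coef2 c (Q y) (M y) (q1 y) (q2 y) (m1 y) (m2 y).
pose r3 y := coef3 c (Q y) (M y) (q1 y) (q2 y) (m1 y) (m2 y).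
pose r4 y := coef4 (q1 y) (q2 y) (m1 y) (m2 y).
pose dd y := d1 y ^+ 2 + d2 y ^+ 2 + d3 y ^+ 2 + d4 y ^+ 2.
pose vv y := q1 y ^+ 2 + q2 y ^+ 2 + m1 y ^+ 2 + m2 y ^+ 2.
have ie0 : intI e0 by apply: contI_integrable; rewrite /e0; continuity.
have i1 : intI (fun y => pQ y * d1 y) by apply: L2M_integrable => //; exact: contI_L2.
have i3 : intI (fun y => pM y * d3 y) by apply: L2M_integrable => //; exact: contI_L2.
have iel : intI (fun y => ((4 * Q y * (Q y ^+ 2 - 1) - c * M y ^+ 2) * q1 y
  + (M y * (M y ^+ 2 - 1) - 2 * c * Q y * M y) * m1 y)).
  by apply: contI_integrable; continuity.
have ie1 : intI e1 by apply: intID => //; apply/intIZ/intID.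
have ir2 : intI r2 by apply: contI_integrable; rewrite /r2 /coef2; continuity.
have ir3 : intI r3 by apply: contI_integrable; rewrite /r3 /coef3; continuity.
have ir4 : intI r4 by apply: contI_integrable; rewrite /r4 /coef4; continuity.
have ivv : intI vv by apply: contI_integrable; rewrite /vv; continuity.
have [j1 j2 j3 j4] : [/\ intI (fun y => d1 y ^+ 2), intI (fun y => d2 y ^+ 2),
    intI (fun y => d3 y ^+ 2) & intI (fun y => d4 y ^+ 2)].
  by split; [case/L2P: L1|case/L2P: L2'|case/L2P: L3|case/L2P: L4].
have idd : intI dd by rewrite /dd; do 3 apply: intID => //.
have ie2 : intI (fun y => l / 2 * dd y + r2 y) by apply: intID => //; exact: intIZ.
pose J f := \int[mu]_(y in I) f y.
have Jdd : J dd = J (fun y => d1 y ^+ 2) + J (fun y => d2 y ^+ 2)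
    + J (fun y => d3 y ^+ 2) + J (fun y => d4 y ^+ 2).
  by rewrite /J /dd !RintID//; do ?apply: intID.
have Jvv : J vv <= 4 * J dd.
  have p1 := poincare cq1 w1 q1l; have p2 := poincare cq2 w2 q2l.
  have p3 := poincare cm1 w3 m1l; have p4 := poincare cm2 w4 m2l.
  have -> : J vv = J (fun y => q1 y ^+ 2) + J (fun y => q2 y ^+ 2)
      + J (fun y => m1 y ^+ 2) + J (fun y => m2 y ^+ 2).
    by rewrite /J /vv !RintID//; do ?apply: intID; apply: contI_integrable; continuity.
  by rewrite Jdd /J; lra.
have Je1 : J e1 = 0.
  have b1 := weak_derivative_ibp cq1 w1 q1l q1r CpQ.
  have b3 := weak_derivative_ibp cm1 w3 m1l m1r CpM.
  rewrite /J /e1 RintID//; last exact/intIZ/intID.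
  rewrite RintIZ; last exact: intID.
  rewrite RintID// b1 b3.
  have k1 : intI (fun y => fQ y * q1 y) by apply: contI_integrable; continuity.
  have k3 : intI (fun y => fM y * m1 y) by apply: contI_integrable; continuity.
  rewrite -opprD -RintID// mulrN -RintIZ; last exact: intID.
  apply/eqP; rewrite addrC subr_eq0; apply/eqP.
  by apply: eq_Rintegral => y; rewrite inE => Iy; rewrite -(eqQ Iy) -(eqM Iy); ring.
have Jexp t : energy l c (perturb base t (Config q1 q2 m1 m2)) =
    J (fun y => e0 y + t * e1 y + t ^+ 2 * (l / 2 * dd y + r2 y) + t ^+ 3 * r3 y
       + t ^+ 4 * r4 y).
  have wt1 := weak_derivative_lin t cQ cq1 wQ w1.
  have wt2 := weak_derivative_lin t (@contI_cst 0) cq2 w0 w2.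
  have wt3 := weak_derivative_lin t cM cm1 wM w3.
  have wt4 := weak_derivative_lin t (@contI_cst 0) cm2 w0 w4.
  (* The density contains chosen weak derivatives, so the expansion of the integrand holds only
     almost everywhere. *)
  have x1 := weak_deriveP wt1; have x2 := weak_deriveP wt2.
  have x3 := weak_deriveP wt3; have x4 := weak_deriveP wt4.
  have u1 := weak_derivative_unique x1 wt1; have u2 := weak_derivative_unique x2 wt2.
  have u3 := weak_derivative_unique x3 wt3; have u4 := weak_derivative_unique x4 wt4.
  have m_int (f : R -> R) : intI f -> measurable_fun I f.
    by move=> intf; apply/measurable_EFinP; exact: measurable_int intf.
  apply: ae_eq_RintI.
  - apply: m_int; rewrite /energy_density /=.
    have [[/L2P[_ s1] _] [/L2P[_ s2] _] [/L2P[_ s3] _] [/L2P[_ s4] _]] := And4 x1 x2 x3 x4.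
    do 4 (apply: intID; last by apply: contI_integrable; continuity).
    by apply: intIZ; do 3 apply: intID => //.
  - apply: m_int; do 4 (apply: intID; last exact: intIZ).
    exact: ie0.
  - have aeF := ae_filter_ringOfSetsType mu.
    have u12 := filterI u1 u2; have u34 := filterI u3 u4.
    move: u12 u34 => /(_ aeF) u12 /(_ aeF) u34.
    apply: filterS2 u12 u34 => y [h1 h2] [h3 h4] Iy.
    rewrite /energy_density /= h1// h2// h3// h4//.
    by rewrite /e0 /e1 /dd /r2 /r3 /r4 /coef2 /coef3 /coef4; field.
exists (J e0), (J (fun y => l / 2 * dd y + r2 y)), (J r3), (J r4), (J dd); split.
- move=> t; rewrite Jexp /J RintID; [|by do ?[assumption|apply: intID|apply: intIZ]|exact: intIZ].
  rewrite RintID; [|by do ?[assumption|apply: intID|apply: intIZ]|exact: intIZ].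
  rewrite RintID; [|by do ?[assumption|apply: intID|apply: intIZ]|exact: intIZ].
  rewrite RintID; [|by []|exact: intIZ].
  by rewrite !RintIZ// -/(J e1) Je1 mulr0 addr0.
- have : J (fun y => l / 2 * dd y + - coercivity c * vv y) <=
      J (fun y => (l / 2 * dd y + r2 y) + r3 y + r4 y).
    apply: le_RintI.
    + by do ?[assumption|apply: intID|apply: intIZ].
    + by do ?[assumption|apply: intID|apply: intIZ].
    + move=> y Iy; rewrite -!(addrA (l / 2 * _)) lerD2l.
      exact: remainder_ge (ltW c0) (bQ Iy) (bM Iy).
  rewrite /J RintID; [|exact: intIZ|exact: intIZ].
  rewrite RintIZ// RintIZ// (RintID (intID ie2 ir3) ir4) (RintID ie2 ir3).
  move: Jvv; rewrite /J; have : 0 <= coercivity c.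
    by rewrite /coercivity; have := sqr_ge0 c; move: c0; lra.
  nra.
- have : J (fun y => l * dd y + - coercivity c * vv y) <=
      J (fun y => 2 * (l / 2 * dd y + r2 y) + 3 * r3 y + 4 * r4 y).
    apply: le_RintI.
    + by do ?[assumption|apply: intID|apply: intIZ].
    + by do ?[assumption|apply: intID|apply: intIZ].
    + move=> y Iy.
      have := remainder_derivative_ge (q1 y) (q2 y) (m1 y) (m2 y) (ltW c0) (bQ Iy) (bM Iy).
      by rewrite /vv /r2 /r3 /r4; lra.
  rewrite /J RintID; [|exact: intIZ|exact: intIZ].
  have k2 := @intIZ 2 _ ie2; have k3 := @intIZ 3 _ ir3; have k4 := @intIZ 4 _ ir4.
  rewrite (RintID (intID k2 k3) k4) (RintID k2 k3) !RintIZ//.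
  move: Jvv; rewrite /J; have : 0 <= coercivity c.
    by rewrite /coercivity; have := sqr_ge0 c; move: c0; lra.
  nra.
- by rewrite Jdd !addr_ge0//; exact: RintI_sqr_ge0.
- move=> D0 y Iy.
  have g1 := RintI_sqr_ge0 d1; have g2 := RintI_sqr_ge0 d2.
  have g3 := RintI_sqr_ge0 d3; have g4 := RintI_sqr_ge0 d4.
  have s1 := sobolev_bound cq1 w1 q1l Iy; have s2 := sobolev_bound cq2 w2 q2l Iy.
  have s3 := sobolev_bound cm1 w3 m1l Iy; have s4 := sobolev_bound cm2 w4 m2l Iy.
  move: D0; rewrite Jdd /J => D0.
  have z (x k : R) : x ^+ 2 <= 2 * k -> k <= 0 -> x = 0.
    move=> xk k0; apply/eqP; rewrite -sqrf_eq0 eq_le sqr_ge0 andbT.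
    by rewrite (le_trans xk)// pmulr_rle0.
  clear -g1 g2 g3 g4 s1 s2 s3 s4 D0 z.
  by split; [apply: z s1 _|apply: z s2 _|apply: z s3 _|apply: z s4 _]; lra.
Qed.

End EnergyExpansion.

(* The right-hand sides of the equations for [Q11] and [M1] at [Q12 = M2 = 0]. *)
Definition reaction (c : R) (i : bool) (a b : R) :=
  if i then 4 * a * (a ^+ 2 - 1) - c * b ^+ 2
  else b * (b ^+ 2 - 1) - 2 * c * a * b.

(** The two components give [40 + 4 * c] and [10 + 8 * c]. *)
Lemma reaction_bound (c a b : R) (i : bool) : 0 < c -> `|a| <= 2 -> `|b| <= 2 ->
  `|reaction c i a b| <= 40 + 8 * c.
Proof.
move=> c0 ba bb.
have a2 := sqr_le4 ba; have b2 := sqr_le4 bb.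
have n2 (x : R) : x ^+ 2 <= 4 -> `|x ^+ 2 - 1| <= 5.
  by move=> x2; have := sqr_ge0 x; rewrite ler_norml => ?; apply/andP; split; lra.
have p (x y : R) : `|x| <= 2 -> `|y| <= 5 -> `|x * y| <= 10.
  move=> hx hy; rewrite normrM (_ : 10 = 2 * 5); last by ring.
  by apply: ler_pM.
rewrite /reaction; case: i.
- have h1 := p _ _ ba (n2 _ a2).
  have h2 : 0 <= c * b ^+ 2 <= c * 4.
    by rewrite mulr_ge0 ?sqr_ge0 ?(ltW c0)//= ler_pM2l.
  rewrite -mulrA; move: h1 h2; rewrite !ler_norml => /andP[? ?] /andP[? ?].
  apply/andP; split; lra.
- have h1 := p _ _ bb (n2 _ b2).
  have h2 : `|c * (a * b)| <= c * 4.
    rewrite normrM gtr0_norm// ler_pM2l// normrM (_ : 4 = 2 * 2); last by ring.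
    by apply: ler_pM.
  have -> : 2 * c * a * b = 2 * (c * (a * b)) by ring.
  move: h1 h2; rewrite !ler_norml => /andP[? ?] /andP[? ?].
  apply/andP; split; lra.
Qed.

(** Each cubic [x ^+ 3 - x] has a difference with the factor [x - y], the cofactor being at most 13
    in size. The two components give [52 + 4 * c] and [13 + 8 * c]. *)
Lemma reaction_lipschitz (c a b a' b' d : R) (i : bool) : 0 < c ->
  `|a| <= 2 -> `|b| <= 2 -> `|a'| <= 2 -> `|b'| <= 2 ->
  `|a - a'| <= d -> `|b - b'| <= d ->
  `|reaction c i a b - reaction c i a' b'| <= (52 + 8 * c) * d.
Proof.
move=> c0 ba bb ba' bb' da db.
have d0 : 0 <= d by exact: le_trans (normr_ge0 _) da.
have cub (x y : R) : `|x| <= 2 -> `|y| <= 2 -> `|x - y| <= d ->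
    `|(x - y) * (x ^+ 2 + x * y + y ^+ 2 - 1)| <= d * 13.
  move=> hx hy hd; rewrite normrM ler_pM//.
  have x2 := sqr_le4 hx; have y2 := sqr_le4 hy.
  have : `|x * y| <= 4.
    by rewrite normrM (_ : 4 = 2 * 2); [exact: ler_pM|ring].
  have := sqr_ge0 x; have := sqr_ge0 y.
  by rewrite !ler_norml => ? ? /andP[? ?]; apply/andP; split; lra.
have lin (x y z : R) : `|x| <= 2 -> `|y| <= 2 -> `|z| <= d -> `|c * ((x + y) * z)| <= c * (4 * d).
  move=> hx hy hz; rewrite normrM gtr0_norm// ler_pM2l// normrM ler_pM//.
  by rewrite (le_trans (ler_normD _ _))//; lra.
rewrite /reaction; case: i.
- have h1 := cub _ _ ba ba' da; have h2 := lin _ _ _ bb bb' db.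
  have -> : 4 * a * (a ^+ 2 - 1) - c * b ^+ 2 - (4 * a' * (a' ^+ 2 - 1) - c * b' ^+ 2) =
    4 * ((a - a') * (a ^+ 2 + a * a' + a' ^+ 2 - 1)) - c * ((b + b') * (b - b')) by ring.
  have cd : 0 <= c * d by rewrite mulr_ge0 ?(ltW c0).
  move: h1 h2; rewrite !ler_norml => /andP[? ?] /andP[? ?].
  apply/andP; split; lra.
- have h1 := cub _ _ bb bb' db.
  have h2 : `|c * (a * (b - b'))| <= c * (2 * d).
    by rewrite normrM gtr0_norm// ler_pM2l// normrM ler_pM.
  have h3 : `|c * (b' * (a - a'))| <= c * (2 * d).
    by rewrite normrM gtr0_norm// ler_pM2l// normrM ler_pM.
  have -> : b * (b ^+ 2 - 1) - 2 * c * a * b - (b' * (b' ^+ 2 - 1) - 2 * c * a' * b') =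
    (b - b') * (b ^+ 2 + b * b' + b' ^+ 2 - 1)
    - 2 * (c * (a * (b - b')) + c * (b' * (a - a'))) by ring.
  move: h1 h2 h3; rewrite !ler_norml => /andP[? ?] /andP[? ?] /andP[? ?].
  apply/andP; split; lra.
Qed.

(** [416 + 64 * c] is 8 times the Lipschitz constant [52 + 8 * c], as the contraction requires; it
    also exceeds 4 times the bound [40 + 8 * c]. *)
Lemma solution_exists (l c : R) : 0 < c -> 416 + 64 * c <= l ->
  exists Q M pQ pM fQ fM,
  [/\ solves_bvp Q pQ fQ 1 (-1), solves_bvp M pM fM 1 (-1),
      forall y, I y -> `|Q y| <= 2 /\ `|M y| <= 2,
      forall y, I y -> l * fQ y = 4 * Q y * (Q y ^+ 2 - 1) - c * M y ^+ 2 &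
      forall y, I y -> l * fM y = M y * (M y ^+ 2 - 1) - 2 * c * Q y * M y].
Proof.
move=> c0 lc; have l0 : 0 < l by lra.
pose N (i : bool) (a b : R) := l^-1 * reaction c i a b.
have Nc i f g : continuous f -> continuous g -> continuous (fun y => N i (f y) (g y)).
  have mul (h k : R -> R) : continuous h -> continuous k -> continuous (fun y => h y * k y).
    by move=> ch ck y; apply: cvgM; [exact: ch|exact: ck].
  have sub (h k : R -> R) : continuous h -> continuous k -> continuous (fun y => h y - k y).
    by move=> ch ck y; apply: cvgB; [exact: ch|exact: ck].
  have cst (k : R) : continuous (fun _ : R => k) by move=> y; exact: cvg_cst.
  move=> cf cg; apply: (mul (fun _ => l^-1)); first exact: cst.
  rewrite /reaction; case: i.
  - apply: (sub (fun y => _)); last by apply: (mul (fun _ => c)); [exact: cst|exact: mul].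
    apply: (mul (fun y => 4 * f y)); first by apply: (mul (fun _ => 4)); [exact: cst|].
    by apply: (sub (fun y => _) (fun _ => 1)); [exact: mul|exact: cst].
  - apply: (sub (fun y => _)).
      apply: (mul g) => //; apply: (sub (fun y => g y * g y) (fun _ => 1)).
        exact: mul.
      exact: cst.
    apply: (mul (fun y => 2 * c * f y) g) => //.
    by apply: (mul (fun _ => 2 * c) f) => //; exact: cst.
have Nb i a b : `|a| <= 2 -> `|b| <= 2 -> `|N i a b| <= 1 / 4.
  move=> ba bb; have := reaction_bound i c0 ba bb; rewrite /N normrM gtr0_norm ?invr_gt0// => h.
  by rewrite ler_pdivrMl// (le_trans h)//; lra.
have Nl i a b a' b' d : `|a| <= 2 -> `|b| <= 2 -> `|a'| <= 2 -> `|b'| <= 2 ->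
    `|a - a'| <= d -> `|b - b'| <= d -> `|N i a b - N i a' b'| <= d / 8.
  move=> ba bb ba' bb' da db; have h := reaction_lipschitz i c0 ba bb ba' bb' da db.
  rewrite /N -mulrBr normrM gtr0_norm ?invr_gt0// ler_pdivrMl// (le_trans h)//.
  have d0 : 0 <= d by exact: le_trans (normr_ge0 _) da.
  by rewrite (_ : l * (d / 8) = l / 8 * d) ?ler_wpM2r//; [lra|ring].
have [u [p [f h]]] := picard_bvp Nc Nb Nl.
have [ht et bt] := h true; have [hf ef bf] := h false.
exists (u true), (u false), (p true), (p false), (f true), (f false); split=> //.
- by move=> y Iy; split; [exact: bt|exact: bf].
- by move=> y Iy; rewrite et// /N mulrA mulfV ?mul1r// gt_eqF.
- by move=> y Iy; rewrite ef// /N mulrA mulfV ?mul1r// gt_eqF.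
Qed.

(** The direction is [v = w - u]. Moving from [w] along [v] stays on the line through [u], with the
    parameter shifted by 1, so criticality of [w] concerns the derivative at 1 of the quartic based
    at [u]. *)
Lemma perturbation_sub (w : config R) Q M pQ pM fQ fM : admissible w ->
  solves_bvp Q pQ fQ 1 (-1) -> solves_bvp M pM fM 1 (-1) ->
  exists2 v, perturbation v &
    (forall t, perturb w t v = perturb (base Q M) (1 + t) v) /\
    ((forall y, I y -> [/\ Q11 v y = 0, Q12 v y = 0, M1 v y = 0 & M2 v y = 0]) ->
     config_eq w (base Q M)).
Proof.
case: w => a b m n [/= [Wa Wb Wm Wn] [a1 m1 a2 m2] [b1 b2 n1 n2]].
move=> [CQ _ Ql Qr] [CM _ Ml Mr].
have W0 : W12 (fun _ : R => 0 : R) := C1_W12 (C1_cst 0).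
exists (Config (fun y => a y - Q y) (fun y => b y - 0) (fun y => m y - M y) (fun y => n y - 0)).
  split; split=> /=.
  - exact: W12B Wa (C1_W12 CQ).
  - by rewrite a1 Ql subrr.
  - by rewrite a2 Qr subrr.
  - exact: W12B Wb W0.
  - by rewrite b1 subrr.
  - by rewrite b2 subrr.
  - exact: W12B Wm (C1_W12 CM).
  - by rewrite m1 Ml subrr.
  - by rewrite m2 Mr subrr.
  - exact: W12B Wn W0.
  - by rewrite n1 subrr.
  - by rewrite n2 subrr.
split=> [t|v0 y Iy].
  by congr Config; apply/funext => y /=; ring.
move: Iy; rewrite inE => Iy; have [/= e1 e2 e3 e4] := v0 y Iy.
by split; apply/eqP; rewrite -subr_eq0; apply/eqP.
Qed.

Lemma is_derive_quartic (E0 E2 E3 E4 s : R) :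
  is_derive (0 : R) (1 : R) (fun t : R => E0 + (s + t) ^+ 2 * E2 + (s + t) ^+ 3 * E3
    + (s + t) ^+ 4 * E4) (2 * s * E2 + 3 * s ^+ 2 * E3 + 4 * s ^+ 3 * E4).
Proof.
apply: is_derive_eq.
rewrite /GRing.scale /= !addr0; ring.
Qed.

End WeakDerivatives.

Theorem theorem2p5 (R : realType) (c : R) (hc : 0 < c) :
  exists2 lstar : R, 0 < lstar & forall l : R, lstar < l ->
    exists u : config R,
      [/\ critical_point l c u,
          forall w, critical_point l c w -> config_eq w u,
          global_minimiser l c u &
          forall w, global_minimiser l c w -> config_eq w u].
Proof.
have c2 := sqr_ge0 c.
(* The first two terms give existence; the last makes [l / 2 - 4 * coercivity c] positive, and with
   it [l - 4 * coercivity c]. *)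
exists (416 + 64 * c + 8 * coercivity c); first by rewrite /coercivity; lra.
move=> l hl; have l1 : 416 + 64 * c <= l by move: hl; rewrite /coercivity; lra.
have l2 : 0 < l / 2 - 4 * coercivity c by lra.
have l3 : 0 < l - 4 * coercivity c by move: hl; rewrite /coercivity; lra.
have l0 : 0 < l by lra.
have [Q [M [pQ [pM [fQ [fM [sQ sM bQM eQ eM]]]]]]] := solution_exists hc l1.
have bQ y Iy := (bQM y Iy).1; have bM y Iy := (bQM y Iy).2.
have expand := energy_expansion hc sQ sM bQ bM eQ eM.
have adm := admissible_base sQ sM.
have perturb0 (z v : config R) : perturb z 0 v = z.
  by case: z => *; congr Config; apply/funext => y /=; rewrite mul0r addr0.
exists (base Q M).
have crit w : critical_point l c w -> config_eq w (base Q M).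
  move=> [aw cw]; have [v pv [wv v0]] := perturbation_sub aw sQ sM.
  have [E0 [E2 [E3 [E4 [D [eE _ lb _ zero]]]]]] := expand v pv.
  apply/v0/zero; have := cw v pv.
  rewrite (_ : (fun t => _) = fun t => E0 + (1 + t) ^+ 2 * E2 + (1 + t) ^+ 3 * E3
    + (1 + t) ^+ 4 * E4); last by apply/funext => t; rewrite wv eE.
  (* Comparing the two values of the derivative gives [2 * E2 + 3 * E3 + 4 * E4 = 0], so the lower
     bound forces [D <= 0]. *)
  move=> [_ d0]; have [_] := is_derive_quartic E0 E2 E3 E4 1.
  rewrite d0 !expr1n !mulr1 => d1; rewrite -d1 in lb.
  by rewrite -(pmulr_rle0 _ l3).
have lower w : admissible w -> exists2 D : R,
    (l / 2 - 4 * coercivity c) * D <= energy l c w - energy l c (base Q M) &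
    0 <= D /\ (D <= 0 -> config_eq w (base Q M)).
  move=> aw; have [v pv [wv v0]] := perturbation_sub aw sQ sM.
  have [E0 [E2 [E3 [E4 [D [eE lb _ D0 zero]]]]]] := expand v pv.
  exists D; last split => //.
    (* On the line through [u] with direction [v], [w] is the point [t = 1] and [u] the point
       [t = 0]. *)
    rewrite -[w](perturb0 _ v) wv addr0 eE -[X in _ - energy _ _ X](perturb0 _ v) eE.
    by rewrite !expr1n !expr0n /= !mul0r !mul1r; lra.
  by move=> /zero.
split=> //.
- split=> // v pv; have [E0 [E2 [E3 [E4 [D [eE _ _ _ _]]]]]] := expand v pv.
  have := is_derive_quartic E0 E2 E3 E4 0.
  rewrite mulr0 !expr0n /= !mulr0 !mul0r !addr0.
  by congr is_derive; apply/funext => t; rewrite eE add0r.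
- split=> // w aw; have [D lb [D0 _]] := lower w aw.
  by rewrite -subr_ge0 (le_trans _ lb)// mulr_ge0 ?(ltW l2).
- move=> w [aw mw]; have [D lb [D0 zero]] := lower w aw.
  apply: zero; rewrite -(pmulr_rle0 _ l2) (le_trans lb)// subr_le0.
  exact: mw.
Qed.
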